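(* The following upper bounds hold: $R_{(5,5)}\le0.16894$, $R_{(6,5)}\le0.34512$, $R_{(6,6)}\le0.08475$, $R_{(7,6)}\le0.19897$, $R_{(8,6)}\le0.31799$, $R_{(9,6)}\le0.43237$, $R_{(10,6)}\le0.53909$, $R_{(11,6)}\le0.63766$, $R_{(12,6)}\le0.72848$, $R_{(13,6)}\le0.81227$, $R_{(14,6)}\le0.88978$, $R_{(7,7)}\le0.04090$, $R_{(8,7)}\le0.10865$, $R_{(9,7)}\le0.19054$, $R_{(10,7)}\le0.27741$, $R_{(11,7)}\le0.36424$, $R_{(12,7)}\le0.44850$, $R_{(13,7)}\le0.52902$, $R_{(14,7)}\le0.60538$, $R_{(8,8)}\le0.01889$, $R_{(9,8)}\le0.05616$, $R_{(10,8)}\le0.10791$, $R_{(11,8)}\le0.16878$, $R_{(12,8)}\le0.23451$, $R_{(13,8)}\le0.30214$, $R_{(14,8)}\le0.36974$, $R_{(10,9)}\le0.02773$, $R_{(11,9)}\le0.05796$, $R_{(12,9)}\le0.09730$, $R_{(13,9)}\le0.14332$, $R_{(14,9)}\le0.19382$, $R_{(11,10)}\le0.01321$, $R_{(12,10)}\le0.02978$, $R_{(13,10)}\le0.05342$, $R_{(14,10)}\le0.08332$, $R_{(13,11)}\le0.01476$, $R_{(14,11)}\le0.02815$, $R_{(14,12)}\le0.00712$, $R_{(15,13)}\le0.00335$.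
   Context: All logarithms are to base 2. For integers $b\ge k$ and $n\ge1$, a $(b,k)$-hash code of length $n$ is a subset $C\subseteq\{1,\dots,b\}^n$ such that for any $k$ distinct elements of $C$ there is a coordinate in which they are pairwise distinct; $A(b,k,n)$ is the largest size of such a code and $R_{(b,k)}=\limsup_{n\to\infty}\frac1n\log A(b,k,n)$. *)

(* Defs.v *)
From HB Require Import structures.
From mathcomp Require Import all_boot all_order all_algebra.
From mathcomp Require Import all_classical all_reals all_analysis.
Set Implicit Arguments. Unset Strict Implicit. Unset Printing Implicit Defensive.
Import Order.TTheory GRing.Theory Num.Theory.
Local Open Scope ring_scope.

Definition word (b n : nat) := {ffun 'I_n -> 'I_b}.

Definition is_hash_code (b k n : nat) (C : {set word b n}) : bool :=
  [forall S : {set word b n},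
     ((S \subset C) && (#|S| == k)) ==>
     [exists i : 'I_n, [forall x in S, forall y in S, (x i == y i) ==> (x == y)]]].

Definition A_hash (b k n : nat) : nat :=
  \max_(C : {set word b n} | is_hash_code k C) #|C|.

Definition log2 {R : realType} (x : R) : R := ln x / ln 2.

Definition hash_rate (R : realType) (b k : nat) : \bar R :=
  limn_esup (fun n : nat => (log2 ((A_hash b k n)%:R : R) / n%:R)%:E).

(* Main.v *)
Require Import Defs.
From HB Require Import structures.
From mathcomp Require Import all_boot all_order all_algebra.
From mathcomp Require Import all_classical all_reals all_analysis.
From mathcomp Require Import fintype finset ring lra.
From Stdlib Require BinNat Nnat.
Set Implicit Arguments. Unset Strict Implicit. Unset Printing Implicit Defensive.
Import Order.TTheory GRing.Theory Num.Theory.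
Import numFieldNormedType.Exports.
Local Open Scope ring_scope.

(* Put j = k - 2 and let C be a (b, k)-hash code of size N and length n.

   Fix distinct codewords x_1, ..., x_j.  Any two further codewords y, z are separated, in
   some coordinate, from each other and from all the x_t.  Hansel's lemma then says that
   log N / log (b - j) is essentially at most the sum over the coordinates of the fraction
   of y whose symbol avoids j pairwise distinct symbols of the x_t.

   The x_t are drawn from the subcode on which each of the first l coordinates lies in a
   random cyclic window of j - 1 symbols, so that these coordinates contribute 0.  A subcode
   is chosen with probability proportional to its size, so that its symbol distribution p in
   another coordinate has mean the distribution f of C; the subcodes are large enough for
   repetitions to be rare as long as (b / (j - 1))^l is small against N.

   It remains to bound the mean of f . h(p), h_d(p) being the probability that j symbols
   drawn from p are distinct and avoid d.  Writing f = u + del with u uniform,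
     E [f . h(p)] = E [u . h(p) + del . (h(p) + c p)] - c |del|^2
                 <= E [u . h(p) + |h(p) + c p - mean|^2 / (4 c)]
   and the last bracket is, for p_a + p_d fixed, a convex quadratic in p_a p_d.  It is thus
   maximal at a distribution uniform on some subset, and for c = 2 (b-2)_{j-1} / b^{j-1} the
   whole alphabet wins.  Hence R <= 1 / (1 / log (b / (j - 1)) + 1 / (U log (b - j))) with
   U = (b)_{j+1} / b^{j+1}, and all the stated bounds exceed this value. *)

(** * The extremal problem on the simplex *)

Definition elemsym (R : comNzRingType) (I : finType) (p : I -> R) (S : {set I}) (m : nat) : R :=
  \sum_(A : {set I} | (A \subset S) && (#|A| == m)) \prod_(i in A) p i.

(** Splitting subsets by membership of [a] shows [elemsym] to be affine in each single entry. *)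
Lemma elemsymD1 (R : comNzRingType) (I : finType) (p : I -> R) (S : {set I}) (a : I) (m : nat) :
  a \in S -> elemsym p S m.+1 = elemsym p (S :\ a) m.+1 + p a * elemsym p (S :\ a) m.
Proof.
move=> aS; rewrite /elemsym (bigID (fun A : {set I} => a \notin A)) /=; congr (_ + _).
  by apply: eq_bigl => A; rewrite subsetD1 -!andbA; congr (_ && _); rewrite andbC.
rewrite big_distrr /= (reindex_onto (fun B => a |: B) (fun A => A :\ a)) /=; last first.
  by move=> A /andP[_]; rewrite negbK => aA; rewrite setD1K.
apply: eq_big => [B|B /andP[_ /eqP BE]]; last first.
  have aB : a \notin B by rewrite -BE !inE eqxx.
  by rewrite big_setU1.
rewrite setU11 andbT subsetD1 subUset sub1set aS /=.
have [aB|aB] := boolP (a \in B).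
  rewrite !andbF /=; apply/negbTE/negP => /andP[_ /eqP BE].
  by move: aB; rewrite -BE !inE eqxx.
by rewrite setU1K // eqxx !andbT cardsU1 aB.
Qed.

Lemma eq_elemsym (R : comNzRingType) (I : finType) (p q : I -> R) (S : {set I}) (m : nat) :
  {in S, p =1 q} -> elemsym p S m = elemsym q S m.
Proof.
move=> pq; apply: eq_bigr => A /andP[/subsetP AS _].
by apply: eq_bigr => i /AS /pq.
Qed.

Lemma elemsym_indicator (R : comNzRingType) (I : finType) (c : R) (A S : {set I}) (m : nat) :
  elemsym (fun i => c *+ (i \in A)) S m = 'C(#|S :&: A|, m)%:R * c ^+ m.
Proof.
rewrite /elemsym (bigID (fun B : {set I} => B \subset A)) /= [X in _ + X]big1 ?addr0; last first.
  move=> B /andP[_ /subsetPn[i iB iA]].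
  by rewrite (bigD1 i) //= (negbTE iA) mul0r.
rewrite (eq_bigr (fun _ => c ^+ m)); last first.
  move=> B /andP[/andP[_ /eqP <-] /subsetP BA]; rewrite -[in RHS]prodr_const.
  by apply: eq_bigr => i /BA ->.
rewrite sumr_const -cards_draws mulr_natl; congr (_ *+ _).
by apply: eq_card => B; rewrite !inE subsetI unfold_in /= -!andbA; congr (_ && _); rewrite andbC.
Qed.

Definition simplex (R : numDomainType) (I : finType) (p : I -> R) : Prop :=
  (forall i, 0 <= p i) /\ \sum_i p i = 1.

(* For p on the simplex: the probability that j symbols drawn from p are distinct and differ
   from d. *)
Definition avoid (R : comNzRingType) (I : finType) (j : nat) (p : I -> R) (d : I) : R :=
  j`!%:R * elemsym p (~: [set d]) j.

(** The bracket left after AM-GM in [average_avoid_le]. Subtracting the mean [m] costs nothing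
    there, as the deviation from uniform sums to 0. *)
Definition potential (R : fieldType) (I : finType) (j : nat) (c : R) (p : I -> R) : R :=
  let x d := avoid j p d + c * p d in
  let m := (\sum_d x d) / #|I|%:R in
  (\sum_d avoid j p d) / #|I|%:R + (\sum_d (x d - m) ^+ 2) / (4 * c).

(* p0, p, p1 differ only in the entries a and d, whose sum is fixed; in terms of the product
   of these entries p is the convex combination of p0 and p1 of weight t. *)
Definition pair_segment (R : numDomainType) (I : finType) (a d : I) (t : R) (p p0 p1 : I -> R) : Prop :=
  [/\ forall i, i != a -> i != d -> p0 i = p i /\ p1 i = p i,
      p0 a + p0 d = p a + p d, p1 a + p1 d = p a + p d &
      p a * p d = (1 - t) * (p0 a * p0 d) + t * (p1 a * p1 d)].

(** * Convexity in the product of two entries *)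

Section PairSegment.
Context {R : realFieldType} {I : finType} (j : nat) (a d : I) (t : R) (p p0 p1 : I -> R).
Hypothesis ad : a != d.
Hypothesis seg : pair_segment a d t p p0 p1.

Lemma eq_elemsym_seg (S : {set I}) m : a \notin S -> d \notin S ->
  elemsym p0 S m = elemsym p S m /\ elemsym p1 S m = elemsym p S m.
Proof.
have [pE _ _ _] := seg.
move=> aS dS; split; apply: eq_elemsym => i iS.
  by have [] // := pE i; [apply: contraNneq aS => <- | apply: contraNneq dS => <-].
by have [] // := pE i; [apply: contraNneq aS => <- | apply: contraNneq dS => <-].
Qed.

(** Splitting off [a] and [d] leaves a constant plus multiples of the fixed sum and of the product
    of the two entries, hence an affine function of the product. The index [j.+2] leaves room for
    removing two symbols. *)
Lemma avoid_seg (i : I) : i != a -> i != d ->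
  avoid j.+2 p i = (1 - t) * avoid j.+2 p0 i + t * avoid j.+2 p1 i.
Proof.
move=> ia id; have [_ s0 s1 pE] := seg.
have aS : a \in ~: [set i] by rewrite !inE eq_sym.
have dS : d \in ~: [set i] :\ a by rewrite !inE eq_sym ad eq_sym.
rewrite /avoid !(elemsymD1 _ _ aS) !(elemsymD1 _ _ dS).
set S := _ :\ d; have aS' : a \notin S by rewrite !inE eqxx andbF.
have dS' : d \notin S by rewrite !inE eqxx.
have [e0 e0'] := eq_elemsym_seg j aS' dS'; have [e1 e1'] := eq_elemsym_seg j.+1 aS' dS'.
have [e2 e2'] := eq_elemsym_seg j.+2 aS' dS'.
rewrite e0 e0' e1 e1' e2 e2'.
move: (elemsym p S _) (elemsym p S _) (elemsym p S _) => E0 E1 E2.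
rewrite -[p0 a](addrK (p0 d)) -[p1 a](addrK (p1 d)) -[p a](addrK (p d)) in pE *.
rewrite s0 s1 in pE *; ring: pE.
Qed.

(** At [a] only the entry of [d] enters, and conversely, with the same coefficient [B], common to
    [p], [p0] and [p1]. So the pair sum sees only [p a + p d], while the difference scales with
    [p a - p d]. *)
Lemma avoid_seg_sum : exists B, [/\
  forall c, let x q i := avoid j.+2 q i + c * q i in
    x p0 a + x p0 d = x p a + x p d /\ x p1 a + x p1 d = x p a + x p d &
  forall c, let x q i := avoid j.+2 q i + c * q i in
    [/\ x p a - x p d = (c - B) * (p a - p d),
    x p0 a - x p0 d = (c - B) * (p0 a - p0 d) &
    x p1 a - x p1 d = (c - B) * (p1 a - p1 d)]].
Proof.
have [_ s0 s1 pE] := seg.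
have a0 : p0 a = p a + p d - p0 d by rewrite -s0 addrK.
have a1 : p1 a = p a + p d - p1 d by rewrite -s1 addrK.
have dS : d \in ~: [set a] by rewrite !inE eq_sym.
have aS : a \in ~: [set d] by rewrite !inE.
have SE : ~: [set d] :\ a = ~: [set a] :\ d by apply/setP => i; rewrite !inE andbC.
exists (j.+2`!%:R * elemsym p (~: [set a] :\ d) j.+1).
rewrite /avoid.
have aS' : a \notin ~: [set a] :\ d by rewrite !inE eqxx andbF.
have dS' : d \notin ~: [set a] :\ d by rewrite !inE eqxx.
have [e0 e0'] := eq_elemsym_seg j.+1 aS' dS'; have [e1 e1'] := eq_elemsym_seg j.+2 aS' dS'.
split=> c /=; rewrite !(elemsymD1 _ _ aS) !(elemsymD1 _ _ dS) SE e0 e0' e1 e1'.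
  move: (elemsym p _ _) (elemsym p _ _) => E0 E1.
  by split; ring: a0 a1.
by move: (elemsym p _ _) (elemsym p _ _) => E0 E1; split; ring.
Qed.

(** The sums and the mean are affine in the product of the two entries, so every square away from
    [a] and [d] is convex in it. The two remaining squares are regrouped into half-squares of a sum
    and a difference: the former is convex, the latter affine. *)
Lemma potential_seg (c : R) : 0 < c -> 0 <= t <= 1 ->
  potential j.+2 c p <= (1 - t) * potential j.+2 c p0 + t * potential j.+2 c p1.
Proof.
move=> c0 /andP[t0 t1]; have [pE s0 s1 prE] := seg.
have [B [/(_ c) /= [xs0 xs1] /(_ c) /= [xd xd0 xd1]]] := avoid_seg_sum.
rewrite /potential /=.
set x := fun i => avoid j.+2 p i + c * p i.
set x0 := fun i => avoid j.+2 p0 i + c * p0 i.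
set x1 := fun i => avoid j.+2 p1 i + c * p1 i.
have xE i : i != a -> i != d -> x i = (1 - t) * x0 i + t * x1 i.
  move=> ia id; rewrite /x /x0 /x1 avoid_seg //; have [-> ->] := pE i ia id; ring.
have sumE (y y0 y1 : I -> R) :
    y0 a + y0 d = y a + y d -> y1 a + y1 d = y a + y d ->
    (forall i, i != a -> i != d -> y i = (1 - t) * y0 i + t * y1 i) ->
    \sum_i y i = (1 - t) * \sum_i y0 i + t * \sum_i y1 i.
  move=> y0E y1E yE.
  rewrite !(bigD1 (P := xpredT) a) //= !(bigD1 (P := fun i => i != a) d) 1?eq_sym //=.
  rewrite (eq_bigr (fun i => (1 - t) * y0 i + t * y1 i)); last first.
    by move=> i /andP[]; exact: yE.
  rewrite big_split -!big_distrr /=.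
  move: (\sum_(i | _) _) (\sum_(i | _) _) => T0 T1.
  have a0 : y0 a = y a + y d - y0 d by rewrite -y0E addrK.
  have a1 : y1 a = y a + y d - y1 d by rewrite -y1E addrK.
  by ring: a0 a1.
have hsE : \sum_i avoid j.+2 p i =
    (1 - t) * \sum_i avoid j.+2 p0 i + t * \sum_i avoid j.+2 p1 i.
  apply: sumE; last by move=> i ia id; rewrite avoid_seg.
  - by apply: (addIr (c * (p a + p d))); rewrite -{1}s0 !mulrDr addrACA xs0 addrACA.
  - by apply: (addIr (c * (p a + p d))); rewrite -{1}s1 !mulrDr addrACA xs1 addrACA.
have xsE : \sum_i x i = (1 - t) * \sum_i x0 i + t * \sum_i x1 i by exact: sumE.
set n := #|I|%:R.
set m := (\sum_d x d) / n; set m0 := (\sum_d x0 d) / n; set m1 := (\sum_d x1 d) / n.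
have mE : m = (1 - t) * m0 + t * m1 by rewrite /m xsE /m0 /m1; ring.
rewrite hsE.
suff VE : \sum_i (x i - m) ^+ 2 <=
    (1 - t) * \sum_i (x0 i - m0) ^+ 2 + t * \sum_i (x1 i - m1) ^+ 2.
  rewrite [leRHS](_ : _ = ((1 - t) * \sum_d avoid j.+2 p0 d + t * \sum_d avoid j.+2 p1 d) / n +
    ((1 - t) * \sum_i (x0 i - m0) ^+ 2 + t * \sum_i (x1 i - m1) ^+ 2) / (4 * c)); last by ring.
  by rewrite lerD2l ler_pM2r // invr_gt0 mulr_gt0.
have sqE (u u0 u1 : R) : u = (1 - t) * u0 + t * u1 -> u ^+ 2 <= (1 - t) * u0 ^+ 2 + t * u1 ^+ 2.
  move=> ->; rewrite -subr_ge0.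
  rewrite (_ : _ - _ = t * (1 - t) * (u0 - u1) ^+ 2); last by ring.
  by rewrite mulr_ge0 ?sqr_ge0 // mulr_ge0 // subr_ge0.
rewrite !(bigD1 (P := xpredT) a) //= !(bigD1 (P := fun i => i != a) d) 1?eq_sym //=.
rewrite !addrA mulrDr [t * _]mulrDr [leRHS]addrACA; apply: lerD; last first.
  rewrite !big_distrr -big_split /=; apply: ler_sum => i /andP[ia id].
  by apply: sqE; rewrite xE // mE; ring.
have splitE (y z M : R) : (y - M) ^+ 2 + (z - M) ^+ 2 = (y + z - 2 * M) ^+ 2 / 2 + (y - z) ^+ 2 / 2.
  by field.
rewrite !splitE -/(x a) -/(x d) -/(x0 a) -/(x0 d) -/(x1 a) -/(x1 d).
rewrite -/(x a) -/(x d) -/(x0 a) -/(x0 d) -/(x1 a) -/(x1 d) in xs0 xs1 xd xd0 xd1.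
rewrite xs0 xs1 xd xd0 xd1.
have := sqE (x a + x d - 2 * m) (x a + x d - 2 * m0) (x a + x d - 2 * m1).
move=> /(_ _)/wrap[]; first by rewrite mE; ring.
have sq (y z : R) : (y - z) ^+ 2 = (y + z) ^+ 2 - 4 * (y * z) by ring.
rewrite !exprMn !sq s0 s1 prE.
by move=> H; lra.
Qed.

End PairSegment.

(** * Maximisation over the simplex *)

Lemma continuous_potential (R : realType) (b j : nat) (c : R) :
  continuous (fun v : 'rV[R]_b => potential j c (v ord0)).
Proof.
have csum (I : finType) (P : pred I) (F : I -> 'rV[R]_b -> R) :
    (forall i, P i -> continuous (F i)) -> continuous (fun v => \sum_(i | P i) F i v).
  by apply: continuous_big; exact: add_continuous.
have cprod (I : finType) (P : pred I) (F : I -> 'rV[R]_b -> R) :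
    (forall i, P i -> continuous (F i)) -> continuous (fun v => \prod_(i | P i) F i v).
  by apply: continuous_big; exact: mul_continuous.
have cmul (F G : 'rV[R]_b -> R) : continuous F -> continuous G ->
    continuous (fun v => F v * G v).
  by move=> cF cG v; exact: (continuousM (cF v) (cG v)).
have cadd (F G : 'rV[R]_b -> R) : continuous F -> continuous G ->
    continuous (fun v => F v + G v).
  by move=> cF cG v; exact: (continuousD (cF v) (cG v)).
have ccst (k : R) : continuous (fun _ : 'rV[R]_b => k) by exact: cst_continuous.
have cavoid d : continuous (fun v : 'rV[R]_b => avoid j (v ord0) d).
  apply: (cmul) => //; apply: (csum) => A _; apply: cprod => i _; exact: coord_continuous.
have cx d : continuous (fun v : 'rV[R]_b => avoid j (v ord0) d + c * v ord0 d).
  apply: (cadd) => //; apply: (cmul) => //; exact: coord_continuous.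
apply: (cadd); first by apply: (cmul) => //; exact: (csum).
apply: (cmul) => //; apply: (csum) => d _.
pose m (v : 'rV[R]_b) := (\sum_e (avoid j (v ord0) e + c * v ord0 e)) / #|'I_b|%:R.
have cm : continuous m by apply: (cmul) => //; exact: (csum).
have cNm : continuous (fun v => - m v) by move=> v; exact: (continuousN (cm v)).
have cxm := cadd _ _ (cx d) cNm.
exact: (cmul _ _ cxm cxm).
Qed.

Lemma compact_simplex (R : realType) (b : nat) :
  compact ([set v : 'rV[R]_b | simplex (v ord0)]%classic).
Proof.
rewrite [X in compact X](_ : _ = ([set v : 'rV[R]_b | forall i, `[0, 1]%classic (v ord0 i)] `&`
  [set v : 'rV[R]_b | \sum_i v ord0 i = 1])%classic).
  apply: compact_closedI.
    by apply: (@rV_compact R b (fun=> `[0, 1]%classic)) => i; exact: (@segment_compact R).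
  have c1 : closed ([set x : R | x = 1]%classic) by exact: closed_eq.
  apply: (@closed_comp _ _ (fun v : 'rV[R]_b => \sum_i v ord0 i) _ _ c1) => v _.
  move: v; apply: continuous_big; first exact: add_continuous.
  by move=> i _; exact: coord_continuous.
apply/seteqP; split=> v /= [v0 v1]; split=> // i; last by have := v0 i; rewrite in_itv /= => /andP[].
rewrite in_itv /= v0 /= -v1 (bigD1 i) //= lerDl.
by apply: sumr_ge0.
Qed.

(* A maximiser of least support must be uniform: were two of its nonzero entries
   different, convexity would let us move one of them to 0. *)
Lemma simplex_le_uniform (R : realType) (b : nat) (G : ('I_b -> R) -> R) (U : R) :
  continuous (fun v : 'rV[R]_b => G (v ord0)) ->
  (forall a d t p p0 p1, a != d -> 0 <= t <= 1 -> pair_segment a d t p p0 p1 ->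
    G p <= (1 - t) * G p0 + t * G p1) ->
  (forall S : {set 'I_b}, S != set0 -> G (fun i => #|S|%:R^-1 *+ (i \in S)) <= U) ->
  forall p, simplex p -> G p <= U.
Proof.
move=> Gc Gconv GU p ps.
have rowE (q : 'I_b -> R) : (\row_i q i) ord0 = q by apply/funext => i; rewrite mxE.
have [|v vs vmax] := @EVT_max_rV R b _ _ _ (@compact_simplex R b) (continuous_subspaceT Gc).
  by exists (\row_i p i); rewrite /= rowE.
have {vs} : simplex (v ord0) by exact: (set_mem vs).
have {vmax} : forall q, simplex q -> G q <= G (v ord0).
  by move=> q qs; rewrite -[q]rowE; apply: vmax; apply: mem_set; rewrite /= rowE.
move: (v ord0) => {v} v vmax vs.
pose supp (q : 'I_b -> R) := #|[set i | q i != 0]|.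
pose P m := `[< exists q, [/\ simplex q, G q = G v & supp q = m] >].
have exP : exists m, P m by exists (supp v); apply/asboolP; exists v.
case: (ex_minnP exP) => m /asboolP[q [qs qv qm]] mmin.
have [q0 q1] := qs.
have qeq a d : q a != 0 -> q d != 0 -> q a = q d.
  move=> qa qd; apply/eqP/negP => /negP qad.
  have ad : a != d by apply: contraNneq qad => ->.
  have qa0 : 0 < q a by rewrite lt_def qa q0.
  have qd0 : 0 < q d by rewrite lt_def qd q0.
  set s := q a + q d; have s0 : 0 < s by exact: addr_gt0.
  (* [r0] gathers the mass of the pair on [a], [r1] shares it equally. The products are 0 and
     [s ^+ 2 / 4], so [t] is the weight that yields [q a * q d]. *)
  pose r0 i := if i == a then s else if i == d then 0 else q i.
  pose r1 i := if i == a then s / 2 else if i == d then s / 2 else q i.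
  pose t := 4 * q a * q d / s ^+ 2.
  have da : (d == a) = false by rewrite eq_sym; apply/negbTE.
  have rs (r : 'I_b -> R) : (forall i, i != a -> i != d -> r i = q i) ->
      0 <= r a -> 0 <= r d -> r a + r d = s -> simplex r.
    move=> rE ra rd rsE; split=> [i|].
      have [->//|ia] := eqVneq i a; have [->//|id] := eqVneq i d; by rewrite rE.
    rewrite -q1 !(bigD1 (P := xpredT) a) //= !(bigD1 (P := fun i => i != a) d) 1?eq_sym //=.
    by rewrite !addrA rsE; congr (_ + _); apply: eq_bigr => i /andP[]; exact: rE.
  have r0s : simplex r0.
    apply: rs; rewrite /r0 ?eqxx ?da ?addr0 ?lexx ?(ltW s0) //.
    by move=> i /negbTE -> /negbTE ->.
  have r1s : simplex r1.
    apply: rs; rewrite /r1 ?eqxx ?da ?divr_ge0 ?(ltW s0) //; last by field.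
    by move=> i /negbTE -> /negbTE ->.
  have t0 : 0 < t by rewrite /t divr_gt0 ?exprn_gt0 ?mulr_gt0.
  have t1 : t < 1.
    rewrite /t ltr_pdivrMr ?exprn_gt0 // mul1r -subr_gt0.
    rewrite (_ : _ - _ = (q a - q d) ^+ 2); last by rewrite /s; ring.
    by rewrite lt_def sqr_ge0 sqrf_eq0 subr_eq0 qad.
  have seg : pair_segment a d t q r0 r1.
    rewrite /pair_segment /r0 /r1 !eqxx da; split.
    - by move=> i /negbTE -> /negbTE ->.
    - by rewrite addr0.
    - by rewrite /s; field.
    - by rewrite /t mulr0 mulr0 add0r; field; rewrite gt_eqF.
  have := Gconv _ _ _ _ _ _ ad _ seg; rewrite (ltW t0) (ltW t1) => /(_ isT) Gq.
  have G1 := vmax _ r1s; have G0 := vmax _ r0s.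
  (* As [t < 1], the endpoint [r0] has positive weight, so it is a maximiser as well; its support
     misses [d], against minimality. *)
  have G0E : G r0 = G v.
    apply/le_anti; rewrite G0 /=; move: Gq; rewrite qv => Gq.
    have : (1 - t) * G v <= (1 - t) * G r0.
      have : t * G r1 <= t * G v by rewrite ler_pM2l.
      lra.
    by rewrite ler_pM2l ?subr_gt0.
  have /mmin : P (supp r0) by apply/asboolP; exists r0.
  rewrite -qm leqNgt => /negP; apply; apply: proper_card.
  apply/properP; split.
    apply/subsetP => i; rewrite !inE /r0.
    by have [->//|_] := eqVneq i a; have [->|] := eqVneq i d; rewrite ?eqxx.
  by exists d; rewrite !inE // /r0 da eqxx eqxx.
set S := [set i | q i != 0].
have S0 : S != set0.
  apply/eqP => S0; have := q1; rewrite big1; first by move/esym/eqP; rewrite oner_eq0.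
  move=> i _; apply/eqP/negP => /negP qi.
  by have := in_set0 i; rewrite -S0 inE qi.
have [a aS] := set0Pn _ S0.
have qE i : q i = q a *+ (i \in S).
  rewrite inE; have [->//|qi] := eqVneq (q i) 0.
  by rewrite mulr1n; apply: qeq => //; rewrite inE in aS.
have qaE : q a = #|S|%:R^-1.
  have : q a * #|S|%:R = 1.
    rewrite -[RHS]q1 (eq_bigr (fun i => if i \in S then q a else 0)).
      by rewrite -big_mkcond /= sumr_const mulr_natr.
    by move=> i _; rewrite qE mulrb.
  have S0' : #|S|%:R != 0 :> R by rewrite pnatr_eq0 -lt0n card_gt0.
  by move=> qaS; apply: (mulIf S0'); rewrite qaS mulVf.
apply: le_trans (vmax _ ps) _; rewrite -qv.
rewrite (_ : q = fun i => #|S|%:R^-1 *+ (i \in S)); first exact: GU.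
by apply/funext => i; rewrite qE qaE.
Qed.

(* With [del = f - uniform], the term [c * p] may be added to [avoid p] for free: the
   average of [del . (c * p)] is [c * |del|^2], which pays for AM-GM. *)
Lemma average_avoid_le (R : realFieldType) (I W : finType) (j : nat) (c U : R)
    (w : W -> R) (p : W -> I -> R) :
  (0 < #|I|)%N -> 0 < c -> (forall q : I -> R, simplex q -> potential j c q <= U) ->
  (forall o, 0 <= w o) -> \sum_o w o = 1 -> (forall o, w o != 0 -> simplex (p o)) ->
  \sum_o w o * \sum_d (\sum_o' w o' * p o' d) * avoid j (p o) d <= U.
Proof.
move=> I0 c0 pU w0 w1 ps.
set f := fun d => \sum_o' w o' * p o' d.
have n0 : #|I|%:R != 0 :> R by rewrite pnatr_eq0 -lt0n.
set n := #|I|%:R in n0.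
have f1 : \sum_d f d = 1.
  rewrite /f exchange_big /= -[RHS]w1; apply: eq_bigr => o _.
  have [->|wo] := eqVneq (w o) 0; first by rewrite big1 // => d _; rewrite mul0r.
  by rewrite -big_distrr /=; have [_ ->] := ps o wo; rewrite mulr1.
pose del d := f d - n^-1.
have del0 : \sum_d del d = 0.
  rewrite big_split /= f1 sumrN sumr_const -[n^-1 *+ _]mulr_natr -/n mulVf //.
  by rewrite subrr.
have fdel : \sum_d del d * f d = \sum_d del d ^+ 2.
  rewrite (eq_bigr (fun d => del d ^+ 2 + del d * n^-1)); last by move=> d _; rewrite /del; ring.
  by rewrite big_split /= -big_distrl /= del0 mul0r addr0.
have bound o : w o != 0 -> \sum_d f d * avoid j (p o) d <=
    U + c * \sum_d del d ^+ 2 - c * \sum_d del d * p o d.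
  move=> wo; have := pU _ (ps o wo); rewrite /potential /= -/n.
  set x := fun d => avoid j (p o) d + c * p o d.
  set m := (\sum_d x d) / n => pot.
  have -> : \sum_d f d * avoid j (p o) d =
      (\sum_d avoid j (p o) d) / n + \sum_d del d * (x d - m) - c * \sum_d del d * p o d.
    have dm : \sum_d del d * (x d - m) = \sum_d del d * x d.
      transitivity (\sum_d del d * x d - (\sum_d del d) * m); last by rewrite del0 mul0r subr0.
      by rewrite big_distrl -sumrB; apply: eq_bigr => d _; rewrite mulrBr.
    rewrite dm big_distrl big_distrr -big_split -sumrB /=.
    by apply: eq_bigr => d _; rewrite /x /del; ring.
  rewrite lerD2r; apply: (@le_trans _ _ ((\sum_d avoid j (p o) d) / n +
     ((\sum_d (x d - m) ^+ 2) / (4 * c) + c * \sum_d del d ^+ 2))).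
    rewrite lerD2l big_distrl big_distrr -big_split /=; apply: ler_sum => d _.
    rewrite -subr_ge0.
    (* Termwise AM-GM: the difference of the two sides is a perfect square over [4 * c]. *)
    rewrite (_ : _ - _ = (2 * c * del d - (x d - m)) ^+ 2 / (4 * c)); last by field; rewrite gt_eqF.
    by rewrite divr_ge0 ?sqr_ge0 // mulr_ge0 // ltW.
  by rewrite addrA lerD2r.
apply: (@le_trans _ _ (\sum_o w o * (U + c * \sum_d del d ^+ 2 - c * \sum_d del d * p o d))).
  apply: ler_sum => o _; have [->|wo] := eqVneq (w o) 0; first by rewrite !mul0r.
  by rewrite ler_wpM2l // bound.
rewrite (eq_bigr (fun o => w o * (U + c * \sum_d del d ^+ 2) - c * (w o * \sum_d del d * p o d)));
  last by move=> o _; ring.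
rewrite sumrB -big_distrl -big_distrr /= w1 mul1r.
have -> : \sum_o w o * (\sum_d del d * p o d) = \sum_d del d ^+ 2.
  rewrite -fdel; under eq_bigr do rewrite big_distrr /=.
  rewrite exchange_big /=; apply: eq_bigr => d _; rewrite big_distrr /=.
  by apply: eq_bigr => o _; ring.
by rewrite addrK.
Qed.

(** * Values at uniform distributions *)

(** The tuples of distinct symbols of [S] other than [d] number [m.-1 ^_ i.+1] or [m ^_ i.+1],
    according as [d] lies in [S] or not; the common factor [m.-1 ^_ i] is pulled out. *)
Lemma avoid_uniform (R : numFieldType) (b i : nat) (S : {set 'I_b}) (d : 'I_b) :
  let m := #|S| in
  avoid i.+1 (fun e => m%:R^-1 *+ (e \in S)) d =
  (if d \in S then m%:R - i.+1%:R else m%:R) * (m.-1 ^_ i)%:R / m%:R ^+ i.+1 :> R.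
Proof.
move=> m; rewrite /avoid elemsym_indicator mulrA -natrM mulnC bin_ffact exprVn; congr (_ / _).
have -> : #|~: [set d] :&: S| = (m - (d \in S))%N.
  by rewrite setIC -setDE /m (cardsD1 d S) addKn.
have [dS|dS] := boolP (d \in S); last first.
  rewrite subn0; have [->|] := posnP m; first by rewrite ffact0n mul0r.
  by case: (m) => // m' _; rewrite ffactnS natrM.
rewrite subn1 ffactnSr natrM mulrC.
have m0 : (0 < m)%N by rewrite card_gt0; apply/set0Pn; exists d.
(* The truncated [m.-1 - i] is the true difference only for [i <= m.-1]; otherwise the falling
   factorial is 0. *)
have [mi|mi] := leqP i m.-1; last by rewrite ffact_small // !mulr0.
by congr (_ * _); rewrite natrB // -!natr1 -[in RHS](prednK m0) -natr1; ring.
Qed.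

(** The shifted values are constant on [S] and off [S], so their squared deviations sum to
    [m * (b - m) / b] times the squared gap between the two. *)
Lemma potential_uniform (R : numFieldType) (b i : nat) (c : R) (S : {set 'I_b}) :
  S != set0 -> c != 0 -> let m := #|S| in let F := (m.-1 ^_ i)%:R in
  potential i.+1 c (fun e => m%:R^-1 *+ (e \in S)) =
  (b%:R - i.+1%:R) * F / (b%:R * m%:R ^+ i) +
  m%:R * (b%:R - m%:R) * (c / m%:R - i.+1%:R * F / m%:R ^+ i.+1) ^+ 2 / (4 * b%:R * c).
Proof.
move=> S0 c0 m F; rewrite /potential /= card_ord.
have m0 : m%:R != 0 :> R by rewrite pnatr_eq0 -lt0n card_gt0.
have mb : (m <= b)%N by rewrite -[b]card_ord max_card.
have b0 : b%:R != 0 :> R by rewrite pnatr_eq0 -lt0n (leq_trans _ mb) // card_gt0.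
have sumE (y1 y0 : R) : \sum_(d < b) (if d \in S then y1 else y0) = m%:R * y1 + (b%:R - m%:R) * y0.
  rewrite (bigID (mem S)) /= (eq_bigr (fun=> y1)); last by move=> d ->.
  rewrite [X in _ + X](eq_bigr (fun=> y0)); last by move=> d /negbTE ->.
  rewrite !sumr_const -[y1 *+ _]mulr_natl -[y0 *+ _]mulr_natl -natrB //; congr (_ + _%:R * _).
  have := cardC (mem S); rewrite card_ord => cE; apply: (@addnI m); rewrite subnKC // -[RHS]cE.
set X1 := (m%:R - i.+1%:R) * F / m%:R ^+ i.+1; set X0 := m%:R * F / m%:R ^+ i.+1.
have avE d : avoid i.+1 (fun e => m%:R^-1 *+ (e \in S)) d = if d \in S then X1 else X0.
  by rewrite avoid_uniform -/m -/F; case: (d \in S).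
have xE d : avoid i.+1 (fun e => m%:R^-1 *+ (e \in S)) d + c * (m%:R^-1 *+ (d \in S)) =
    if d \in S then X1 + c / m%:R else X0.
  by rewrite avE; case: (d \in S); rewrite ?mulr0 ?addr0.
rewrite (eq_bigr _ (fun d _ => avE d)) (eq_bigr _ (fun d _ => xE d)) !sumE.
under eq_bigr do rewrite xE.
set M := (m%:R * (X1 + c / m%:R) + (b%:R - m%:R) * X0) / b%:R.
rewrite (eq_bigr (fun d => if d \in S then (X1 + c / m%:R - M) ^+ 2 else (X0 - M) ^+ 2)); last first.
  by move=> d _; case: (d \in S).
rewrite sumE /M /X1 /X0 exprS.
have mi0 : m%:R ^+ i != 0 :> R by rewrite expf_neq0.
by field; rewrite m0 b0 c0 mi0.
Qed.

(* With j = i.+2 and X / Y = (m-1)_{j-1} b^{j-1} / (m^{j-1} (b-2)_{j-1}), this is the bound of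
   [potential_le] at the uniform distribution on m symbols, cleared of denominators; the
   square (2 Y - j X)^2 is expanded so that no subtraction gets truncated. *)
Definition uniform_check (b i m : nat) : bool :=
  let X := (m.-1 ^_ i.+1 * b ^ i.+1)%N in let Y := (m ^ i.+1 * (b - 2) ^_ i.+1)%N in
  (8 * m * (b - i.+2) * (X * Y) + (b - m) * (4 * (Y * Y) + i.+2 * i.+2 * (X * X)) <=
   8 * m * (b - 1) * (Y * Y) + 4 * (b - m) * i.+2 * (X * Y))%N.

(** The right side is the potential at the uniform distribution on the whole alphabet, the case
    [m = b]; [uniform_check] compares the smaller supports with it. *)
Lemma potential_le (R : realType) (b i : nat) (p : 'I_b -> R) : (i.+3 <= b)%N ->
  (forall m, (0 < m <= b)%N -> uniform_check b i m) -> simplex p ->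
  potential i.+2 (2 * (((b - 2) ^_ i.+1)%:R / b%:R ^+ i.+1)) p <= (b ^_ i.+3)%:R / b%:R ^+ i.+3.
Proof.
move=> ib chk; set g := ((b - 2) ^_ i.+1)%:R; set B := b%:R ^+ i.+1.
have b2 : (2 <= b)%N by apply: leq_trans ib.
have b0 : 0 < b%:R :> R by rewrite ltr0n (leq_trans _ b2).
have g0 : 0 < g by rewrite /g ltr0n ffact_gt0 leq_subRL.
have B0 : 0 < B by rewrite exprn_gt0.
have c0 : 0 < 2 * (g / B) by rewrite mulr_gt0 ?divr_gt0.
apply: simplex_le_uniform.
- exact: continuous_potential.
- by move=> a d t q q0 q1 ad t01 seg; exact: (potential_seg i ad seg c0 t01).
move=> S S0; rewrite potential_uniform ?gt_eqF //.
set m := #|S|; set F := (m.-1 ^_ i.+1)%:R.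
have m0 : (0 < m)%N by rewrite card_gt0.
have mb : (m <= b)%N by rewrite -[b]card_ord max_card.
have m0' : 0 < m%:R :> R by rewrite ltr0n.
have -> : (b ^_ i.+3)%:R / b%:R ^+ i.+3 = (b%:R - 1) * g / (b%:R * B) :> R.
  have -> : (b ^_ i.+3)%:R = b%:R * (b%:R - 1) * g :> R.
    rewrite /g; case: (b) b2 => [|[|b']] // _.
    rewrite !ffactnS !natrM subn2 /= mulrA; congr (_ * _ * _).
    by rewrite -[b'.+2%:R]natr1 addrK.
  have -> : b%:R ^+ i.+3 = b%:R * b%:R * B :> R by rewrite (exprS _ i.+2) (exprS _ i.+1) mulrA.
  by field; rewrite !gt_eqF.
set Mi := m%:R ^+ i.+1; have Mi0 : 0 < Mi by rewrite exprn_gt0.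
rewrite (exprS _ i.+1) -/Mi -subr_ge0.
(* Named naturals hide the two falling factorials, so that distributing casts over products stops at
   them. *)
have [FN FE] : {FN | FN = (m.-1 ^_ i.+1)%N} by exists (m.-1 ^_ i.+1)%N.
have [gN gE] : {gN | gN = ((b - 2) ^_ i.+1)%N} by exists ((b - 2) ^_ i.+1)%N.
have FR : F = FN%:R by rewrite FE.
have gR : g = gN%:R by rewrite gE.
have := chk m; rewrite m0 mb => /(_ isT); rewrite /uniform_check -FE -gE -(ler_nat R).
rewrite !(natrD, natrM, natrX) !natrB // ?(leq_trans _ ib) //.
rewrite -FR -gR -/B -/Mi => chkR.
set J := i.+2%:R in chkR *.
rewrite (_ : _ - _ = (8 * m%:R * (b%:R - 1) * (Mi * g) ^+ 2 - 8 * m%:R * (b%:R - J) * (F * B * (Mi * g))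
  - (b%:R - m%:R) * (2 * (Mi * g) - J * (F * B)) ^+ 2) / (8 * b%:R * m%:R * B * g * Mi ^+ 2)); last first.
  by field; rewrite !gt_eqF.
rewrite divr_ge0 //; last by rewrite !mulr_ge0 // ltW // exprn_gt0.
rewrite -subr_ge0 in chkR; move: chkR; congr (_ <= _); ring.
Qed.

(** * Hansel's lemma *)

Definition column (b n j : nat) (X : {ffun 'I_j -> word b n}) (i : 'I_n) : {ffun 'I_j -> 'I_b} :=
  [ffun t => X t i].

Definition separates (b n j : nat) (X : {ffun 'I_j -> word b n}) (y : word b n) (i : 'I_n) : bool :=
  injectiveb (column X i) && (y i \notin codom (column X i)).

Lemma hash_code_separates (b n j : nat) (C : {set word b n}) (X : {ffun 'I_j -> word b n}) y z :
  is_hash_code j.+2 C -> injective X -> (forall t, X t \in C) -> y \in C -> z \in C ->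
  y \notin codom X -> z \notin codom X -> y != z ->
  exists i, [/\ separates X y i, separates X z i & y i != z i].
Proof.
move=> /forallP hC Xinj XC yC zC yX zX yz.
pose S := y |: (z |: [set x in codom X]).
have cS : #|S| = j.+2.
  by rewrite !cardsU1 !inE negb_or yz yX zX cardsE card_codom // card_ord.
have SC : S \subset C.
  apply/subsetP => x; rewrite !inE => /or3P[/eqP->|/eqP->|/codomP[t ->]] //.
have := hC S; rewrite SC cS eqxx => /existsP[i /forall_inP Hi]; exists i.
have {}Hi x x' : x \in S -> x' \in S -> x i = x' i -> x = x'.
  by move=> xS x'S xx'; have /forall_inP/(_ _ x'S)/implyP := Hi _ xS; rewrite xx' eqxx => /(_ isT)/eqP.
have XS t : X t \in S by rewrite !inE codom_f !orbT.
have yS : y \in S by rewrite !inE eqxx.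
have zS : z \in S by rewrite !inE eqxx orbT.
have cinj : injectiveb (column X i).
  by apply/injectiveP => t t'; rewrite !ffunE => /(Hi _ _ (XS t) (XS t'))/Xinj.
split; rewrite /separates ?cinj //=.
- apply/negP => /codomP[t]; rewrite ffunE => /(Hi _ _ yS (XS t)) yE.
  by move: yX; rewrite yE codom_f.
- apply/negP => /codomP[t]; rewrite ffunE => /(Hi _ _ zS (XS t)) zE.
  by move: zX; rewrite zE codom_f.
- by apply: contraNneq yz => /(Hi _ _ yS zS) ->.
Qed.

(* Kraft-type form of Hansel's lemma: keep one random admissible symbol in every
   coordinate; at most one codeword survives all coordinates. *)
Lemma hash_code_kraft (R : realFieldType) (b n j : nat) (C : {set word b n}) (X : {ffun 'I_j -> word b n}) :
  (j < b)%N -> is_hash_code j.+2 C -> injective X -> (forall t, X t \in C) ->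
  \sum_(y in C | y \notin codom X) ((b - j)%:R^-1 : R) ^+ (\sum_i separates X y i) <= 1.
Proof.
move=> jb hC Xinj XC.
have b0 : b%:R != 0 :> R by rewrite pnatr_eq0 -lt0n (leq_ltn_trans _ jb).
have B0 : (b - j)%:R != 0 :> R by rewrite pnatr_eq0 -lt0n subn_gt0.
pose w i (a : 'I_b) : R := if injectiveb (column X i) then
  (a \notin codom (column X i))%:R / (b - j)%:R else b%:R^-1.
have w0 i a : 0 <= w i a by rewrite /w; case: ifP => _; rewrite ?divr_ge0 ?invr_ge0.
have w1 i : \sum_a w i a = 1.
  rewrite /w; have [cinj|_] := boolP (injectiveb (column X i)); last first.
    by rewrite sumr_const card_ord -[_ *+ _]mulr_natr mulVf.
  rewrite -big_distrl /= -natr_sum.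
  have := cardC (mem (codom (column X i))); rewrite card_codom; last exact/injectiveP.
  rewrite !card_ord => cE; rewrite (_ : (\sum_a _)%N = (b - j)%N) ?mulfV //.
  apply: (@addnI j); rewrite subnKC ?(ltnW jb) // -[RHS]cE; congr (_ + _)%N.
  by rewrite -sum1_card [RHS]big_mkcond /=; apply: eq_bigr => a _; rewrite !inE; case: (_ \in _).
pose surv y i (a : 'I_b) := separates X y i ==> (a == y i).
have survE y i : \sum_a w i a * (surv y i a)%:R = (b - j)%:R^-1 ^+ separates X y i.
  rewrite /surv; have [/andP[cinj yX]|_] := boolP (separates X y i); last first.
    by rewrite expr0 -[RHS](w1 i); apply: eq_bigr => a _; rewrite mulr1.
  rewrite (bigD1 (y i)) //= eqxx mulr1 big1 ?addr0; last by move=> a /negbTE ->; rewrite mulr0.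
  by rewrite /w cinj yX mul1r expr1.
have EE y : (b - j)%:R^-1 ^+ (\sum_i separates X y i) =
    \sum_(phi : {ffun 'I_n -> 'I_b}) (\prod_i w i (phi i)) * [forall i, surv y i (phi i)]%:R.
  rewrite expr_sum -(eq_bigr _ (fun i _ => survE y i)) bigA_distr_bigA /=.
  apply: eq_bigr => phi _; rewrite big_split /=; congr (_ * _).
  have [/forallP sv|/forallPn[i /negbTE si]] := boolP [forall i, surv y i (phi i)].
    by rewrite big1 // => i _; rewrite sv.
  by rewrite (bigD1 i) //= si mul0r.
under eq_bigr do rewrite EE.
rewrite exchange_big /=.
rewrite [leRHS](_ : 1 = \sum_(phi : {ffun 'I_n -> 'I_b}) \prod_i w i (phi i)); last first.
  by rewrite -bigA_distr_bigA big1.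
apply: ler_sum => phi _; rewrite -big_distrr /= ler_piMr ?prodr_ge0 // -natr_sum lern1.
(* Two survivors would both carry the kept symbol at a coordinate where both are separated from [X]
   and from each other. *)
case: (pickP (fun y => [&& y \in C, y \notin codom X & [forall i, surv y i (phi i)]])).
  move=> y /and3P[yC yX /forallP sy].
  rewrite (bigD1 y) ?yC //= big1 ?addn0 ?leq_b1 // => z /andP[/andP[zC zX] zy].
  apply/eqP; rewrite eqb0; apply/negP => /forallP sz.
  have [i [si ti yzi]] := hash_code_separates hC Xinj XC zC yC zX yX zy.
  have := sz i; have := sy i; rewrite /surv si ti /= => /eqP E1 /eqP E2.
  by move: yzi; rewrite -E1 -E2 eqxx.
move=> none; rewrite big1 // => y /andP[yC yX].
by have := none y; rewrite yC yX /= => ->.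
Qed.

(** Jensen's inequality for [expR] on the Kraft sum over the [#|C| - j] words outside [X], followed
    by a logarithm. The words of [X] then enter the right side with nonnegative terms. *)
Lemma hansel (R : realType) (b n j : nat) (C : {set word b n}) (X : {ffun 'I_j -> word b n}) :
  (j < b)%N -> is_hash_code j.+2 C -> injective X -> (forall t, X t \in C) ->
  (#|C| - j)%:R * ln (#|C| - j)%:R <=
  ln (b - j)%:R * \sum_(y in C) \sum_i (separates X y i)%:R :> R.
Proof.
move=> jb hC Xinj XC.
set L := ln (b - j)%:R.
have L0 : 0 <= L by rewrite ln_ge0 // ler1n subn_gt0.
pose dd y := \sum_i (separates X y i)%:R : R.
have dd0 y : 0 <= dd y by apply: sumr_ge0.
set v := (#|C| - j)%N; have [->|v0] := posnP v.
  by rewrite mul0r mulr_ge0 // sumr_ge0 // => y _; exact: dd0.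
have vR : 0 < v%:R :> R by rewrite ltr0n.
have vE : #|[pred y in C | y \notin codom X]| = v.
  have -> : #|[pred y in C | y \notin codom X]| = #|C :\: [set y in codom X]|.
    by apply: eq_card => y; rewrite !inE andbC.
  rewrite cardsD (setIidPr _) ?cardsE ?card_codom ?card_ord //.
  by apply/subsetP => y; rewrite inE => /codomP[t ->].
have kr := hash_code_kraft R jb hC Xinj XC.
pose D := \sum_(y in C | y \notin codom X) dd y; pose mu := D / v%:R.
have expE y : (b - j)%:R^-1 ^+ (\sum_i separates X y i) = expR (- (dd y * L)) :> R.
  rewrite expRN exprVn; congr (_^-1).
  by rewrite /dd -natr_sum expRM_natl /L lnK // posrE ltr0n subn_gt0 //.
have : v%:R * expR (- (mu * L)) <= 1.
  apply: le_trans kr; under [leRHS]eq_bigr do rewrite expE.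
  (* Jensen through the tangent line of [expR] at the mean: its linear terms sum to 0. *)
  apply: (@le_trans _ _ (\sum_(y in C | y \notin codom X) expR (- (mu * L)) * (1 + (mu * L - dd y * L)))).
    rewrite -big_distrr /= big_split /= sumrB !sumr_const vE -[X in _ - X]big_distrl /= -/D.
    rewrite (_ : D = mu * v%:R); last by rewrite /mu divfK // gt_eqF.
    by rewrite -[(mu * L) *+ v]mulr_natr [mu * v%:R * L]mulrAC subrr addr0 mulrC.
  apply: ler_sum => y _; apply: (@le_trans _ _ (expR (- (mu * L)) * expR (mu * L - dd y * L))).
    by rewrite ler_pM2l ?expR_gt0 // expR_ge1Dx.
  by rewrite -expRD addrA addNr add0r.
rewrite expRN ler_pdivrMr ?expR_gt0 // mul1r => vexp.
have lnv : ln v%:R <= mu * L by rewrite -[leRHS]expRK ler_ln ?posrE ?expR_gt0.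
apply: (@le_trans _ _ (v%:R * (mu * L))); first by rewrite ler_pM2l.
rewrite mulrA mulrC ler_wpM2l // /mu mulrC divfK ?gt_eqF //.
rewrite /D [leRHS](bigID (fun y => y \notin codom X)) /= lerDl.
by apply: sumr_ge0 => y _; exact: dd0.
Qed.

(** * Averaging over tuples drawn from a family of subcodes *)

(** Injective tuples are grouped by image: each set of [j] symbols is the image of [j] factorial
    tuples, all with the same product. *)
Lemma sum_injective_avoid (R : numFieldType) (I : finType) (j : nat) (p : I -> R) (d : I) :
  \sum_(a : {ffun 'I_j -> I}) (injectiveb a && (d \notin codom a))%:R * \prod_t p (a t) = avoid j p d.
Proof.
have codomE (a : {ffun 'I_j -> I}) x : (x \in a @: 'I_j) = (x \in codom a).
  by apply/imsetP/codomP => [[t _ ->]|[t ->]]; exists t.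
rewrite (eq_bigr (fun a : {ffun 'I_j -> I} => if injectiveb a && (d \notin codom a) then \prod_t p (a t) else 0)); last first.
  by move=> a _; case: ifP; rewrite ?mul1r ?mul0r.
rewrite -big_mkcond /=.
rewrite (partition_big (fun a : {ffun 'I_j -> I} => a @: 'I_j)
  (fun A => (A \subset ~: [set d]) && (#|A| == j))) /=; last first.
  move=> a /andP[/injectiveP ainj da]; rewrite card_imset // card_ord eqxx andbT.
  by rewrite subsetC sub1set inE codomE.
rewrite /avoid /elemsym big_distrr /=; apply: eq_bigr => A /andP[AS /eqP Aj].
rewrite (eq_bigr (fun=> \prod_(x in A) p x)); last first.
  move=> a /andP[/andP[/injectiveP ainj _] /eqP <-].
  by rewrite big_imset /=; [apply: eq_bigl => t; rewrite inE | move=> s t _ _; exact: ainj].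
rewrite sumr_const mulr_natl; congr (_ *+ _).
have <- : #|A| ^_ #|'I_j| = j`! by rewrite Aj card_ord ffactnn.
rewrite -card_inj_ffuns_on; apply: eq_card => a; rewrite inE unfold_in /=.
have [/injectiveP ainj|_] := boolP (injectiveb a); last by rewrite andbF.
rewrite andbT; apply/andP/ffun_onP => [[_ /eqP <-] t|aA]; first by rewrite imset_f.
have aE : a @: 'I_j = A.
  apply/eqP; rewrite eqEcard card_imset // card_ord Aj leqnn andbT.
  by apply/subsetP => _ /imsetP[t _ ->].
rewrite aE eqxx -codomE aE; split=> //.
by move: AS; rewrite subsetC sub1set inE.
Qed.

(** With [e] the inverse of [#|D|], this is an expectation over [j] independent uniform words of
    [D]; their symbols at [i] are independent too, whence the product. *)
Lemma sum_column (R : numFieldType) (b n j : nat) (D : {set word b n}) (i : 'I_n) (e : R)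
    (F : {ffun 'I_j -> 'I_b} -> R) :
  \sum_(X : {ffun 'I_j -> word b n} | X \in ffun_on (mem D)) e ^+ j * F (column X i) =
  \sum_a F a * \prod_t \sum_(x in D | x i == a t) e.
Proof.
rewrite (partition_big (fun X => column X i) xpredT) //=; apply: eq_bigr => a _.
rewrite bigA_distr_big_dep big_distrr /=; apply: eq_big => [X|X /andP[_ /eqP ->]]; last first.
  by rewrite prodr_const card_ord mulrC.
apply/andP/familyP => [[/ffun_onP XD /eqP <-] t|Xa].
  by rewrite unfold_in /= XD ffunE eqxx.
split; first by apply/ffun_onP => t; have /andP[] := Xa t.
by apply/eqP/ffunP => t; rewrite ffunE; have /andP[_ /eqP] := Xa t.
Qed.

(** A crude birthday bound on repetitions among [j] draws. For [j] above [s] the left side is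
    nonpositive. *)
Lemma ffact_ge (R : realFieldType) (s j : nat) : (0 < s)%N ->
  s%:R ^+ j * (1 - (j ^ 2)%:R / s%:R) <= (s ^_ j)%:R :> R.
Proof.
move=> s0; have sR : 0 < s%:R :> R by rewrite ltr0n.
elim: j => [|j IH]; first by rewrite mul0r subr0 mulr1.
rewrite ffactnSr natrM; have [js|js] := leqP j s; last first.
  apply: (@le_trans _ _ 0); last by rewrite mulr_ge0.
  apply: mulr_ge0_le0; first by rewrite exprn_ge0.
  rewrite subr_le0 ler_pdivlMr // mul1r ler_nat.
  by rewrite (leq_trans (ltnW js)) // (leq_trans (leqnSn j)) // -{1}[j.+1]expn1 leq_pexp2l.
rewrite natrB //; apply: (@le_trans _ _ (s%:R ^+ j * (1 - (j ^ 2)%:R / s%:R) * (s%:R - j%:R))); last first.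
  by rewrite ler_wpM2r // subr_ge0 ler_nat.
rewrite -subr_ge0 !natrX -[j.+1%:R]natr1 (exprS _ j).
rewrite (_ : _ - _ = s%:R ^+ j * (j%:R + 1 + j%:R ^+ 3 / s%:R)); last by field; rewrite gt_eqF.
by rewrite mulr_ge0 ?exprn_ge0 // addr_ge0 // divr_ge0 ?exprn_ge0.
Qed.

(** Hansel's bound is averaged over an index [o] of probability [#|D o| / (#|C| * K)] and [j]
    independent words of [D o]. Repeated words cost the term [j ^ 2 * #|W|]; coordinates in [Z]
    never separate, and any other contributes at most [U] on average by [average_avoid_le]. *)
Lemma hash_code_family_bound (R : realType) (b n j : nat) (C : {set word b n}) (W : finType)
    (D : W -> {set word b n}) (K : nat) (Z : {set 'I_n}) (c U : R) :
  (j < b)%N -> is_hash_code j.+2 C -> (0 < #|C|)%N -> (0 < K)%N ->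
  (forall o, D o \subset C) -> (forall x, x \in C -> #|[set o | x \in D o]| = K) ->
  (forall o i, i \in Z -> (#|[set x i | x : word b n in D o]| < j)%N) ->
  0 < c -> (forall q : 'I_b -> R, simplex q -> potential j c q <= U) ->
  ((#|C| * K)%:R - (j ^ 2 * #|W|)%:R) * ((#|C| - j)%:R * ln (#|C| - j)%:R) <=
  (#|C| * K)%:R * (#|C|%:R * (n - #|Z|)%:R * U * ln (b - j)%:R).
Proof.
move=> jb hC C0 K0 DC DK DZ c0 pU.
set N := #|C|; set L := ln (b - j)%:R; set H := (N - j)%:R * _.
have L0 : 0 <= L by rewrite ln_ge0 // ler1n subn_gt0.
have NK0 : 0 < (N * K)%:R :> R by rewrite ltr0n muln_gt0 C0.
have N0 : 0 < N%:R :> R by rewrite ltr0n.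
(* For an empty [D o] this is 0, and so is the weight [w o]. *)
pose e o : R := #|D o|%:R^-1.
have e0 o : 0 <= e o by rewrite invr_ge0.
pose w o : R := #|D o|%:R / (N * K)%:R.
pose p o i a : R := \sum_(x in D o | x i == a) e o.
have w0 o : 0 <= w o by rewrite divr_ge0.
have sumD (F : word b n -> R) : \sum_o \sum_(x in D o) F x = K%:R * \sum_(x in C) F x.
  rewrite (eq_bigr (fun o => \sum_(x in C) if x \in D o then F x else 0)); last first.
    move=> o _; rewrite -big_mkcondr /=; apply: eq_bigl => x.
    by rewrite andbC; case: (boolP (x \in D o)) => //= /(subsetP (DC o)) ->.
  rewrite exchange_big big_distrr /=; apply: eq_bigr => x xC.
  rewrite -big_mkcond /= sumr_const mulr_natl -(DK x xC); congr (_ *+ _).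
  by apply: eq_card => o; rewrite !inE.
have w1 : \sum_o w o = 1.
  rewrite -big_distrl /= (eq_bigr (fun o => \sum_(x in D o) 1)); last by move=> o _; rewrite sumr_const.
  by rewrite sumD sumr_const -natrM mulnC mulfV // gt_eqF.
have ps i o : w o != 0 -> simplex (p o i).
  move=> wo; have s0 : #|D o|%:R != 0 :> R.
    by apply: contraNneq wo => s0; rewrite /w s0 mul0r.
  split=> [a|]; first by apply: sumr_ge0.
  rewrite -(partition_big (fun x : word b n => x i) xpredT) //= sumr_const.
  by rewrite -mulr_natl mulfV.
have fE i d : \sum_o w o * p o i d = #|[set y in C | y i == d]|%:R / N%:R.
  have E o : w o * p o i d = (\sum_(x in D o) (x i == d)%:R) / (N * K)%:R.
    rewrite /w mulrAC; congr (_ / _); rewrite /p big_mkcondr big_distrr /=.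
    apply: eq_bigr => x xD; case: ifP => _; last by rewrite mulr0.
    rewrite mulfV // pnatr_eq0 -lt0n card_gt0; apply/set0Pn; by exists x.
  rewrite (eq_bigr _ (fun o _ => E o)) -big_distrl /= sumD.
  rewrite -natr_sum natrM (_ : (\sum_(x in C) (x i == d))%N = #|[set y in C | y i == d]|).
    by field; rewrite !pnatr_eq0 -!lt0n C0.
  by rewrite -sum1_card big_mkcond [RHS]big_mkcond /=; apply: eq_bigr => x _; rewrite !inE; case: (x \in C); case: (_ == _).
pose T (X : {ffun 'I_j -> word b n}) : R := \sum_(y in C) \sum_i (separates X y i)%:R.
have T0 X : 0 <= T X by apply: sumr_ge0 => y _; apply: sumr_ge0.
pose avg o := \sum_(X in ffun_on (mem (D o))) e o ^+ j * T X.
have sepE o i y : \sum_(X : {ffun 'I_j -> word b n} | X \in ffun_on (mem (D o)))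
    e o ^+ j * (separates X y i)%:R = avoid j (p o i) (y i).
  rewrite -sum_injective_avoid.
  exact: (sum_column (D o) i (e o) (fun a => (injectiveb a && (y i \notin codom a))%:R)).
(* Pigeonhole: fewer than [j] symbols occur at [i], so the column repeats one. *)
have sepZ o i y (X : {ffun 'I_j -> word b n}) : i \in Z -> X \in ffun_on (mem (D o)) -> separates X y i = false.
  move=> iZ /ffun_onP XD; apply/negbTE/negP => /andP[/injectiveP cinj _].
  have := DZ o i iZ; rewrite ltnNge => /negP; apply.
  rewrite -{1}[j]card_ord -(card_codom cinj); apply: subset_leq_card.
  by apply/subsetP => _ /codomP[t ->]; rewrite ffunE; apply/imsetP; exists (X t) => //; exact: XD.
have upper : \sum_o w o * avg o <= N%:R * (n - #|Z|)%:R * U.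
  have avgE o : avg o = \sum_(i in ~: Z) \sum_(y in C) avoid j (p o i) (y i).
    rewrite /avg /T; under eq_bigr do rewrite exchange_big big_distrr /=.
    rewrite exchange_big /= (bigID (mem Z)) /= big1 ?add0r; last first.
      move=> i iZ; rewrite big1 // => X XD; rewrite big1 ?mulr0 // => y _.
      by rewrite (sepZ o).
    apply: eq_big => [i|i _]; first by rewrite inE.
    under eq_bigr do rewrite big_distrr /=.
    by rewrite exchange_big /=; apply: eq_bigr => y _; exact: sepE.
  under eq_bigr do rewrite avgE big_distrr /=.
  rewrite exchange_big /=.
  rewrite [leRHS](_ : _ = \sum_(i in ~: Z) N%:R * U); last first.
    rewrite sumr_const cardsCs setCK card_ord -[RHS]mulr_natr; ring.
  apply: ler_sum => i _.
  have b0 : (0 < #|'I_b|)%N by rewrite card_ord (leq_ltn_trans _ jb).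
  apply: le_trans (_ : N%:R * (\sum_o w o * \sum_d (\sum_o' w o' * p o' i d) * avoid j (p o i) d) <= _).
    rewrite big_distrr /=; apply: ler_sum => o _; rewrite mulrCA ler_wpM2l // big_distrr /=.
    rewrite (partition_big (fun y : word b n => y i) xpredT) //=; apply: ler_sum => d _.
    rewrite fE [_ / N%:R * _]mulrAC [N%:R * _]mulrC divfK ?gt_eqF // (eq_bigr (fun=> avoid j (p o i) d)); last first.
      by move=> y /andP[_ /eqP ->].
    rewrite sumr_const [leRHS]mulr_natl le_eqVlt; apply/orP; left; apply/eqP; congr (_ *+ _).
    by apply: eq_card => y; rewrite !inE.
  by rewrite ler_pM2l // (average_avoid_le b0 c0 pU w0 w1 (ps i)).
have H0 : 0 <= H.
  rewrite /H; case: (N - j)%N => [|v]; first by rewrite mul0r.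
  by rewrite mulr_ge0 // ln_ge0 // ler1n.
(* Hansel holds for each tuple of distinct words, and [ffact_ge] counts these; for an empty [D o]
   the left side is nonpositive. *)
have lower o : (#|D o|%:R - (j ^ 2)%:R) * H <= #|D o|%:R * (avg o * L).
  have [s0|s0] := posnP #|D o|.
    by rewrite s0 mul0r sub0r mulNr oppr_le0 mulr_ge0.
  have sR : 0 < #|D o|%:R :> R by rewrite ltr0n.
  have : e o ^+ j * ((#|D o| ^_ j)%:R * H) <= avg o * L.
    rewrite /avg big_distrl /=.
    rewrite [leRHS](bigID (fun X : {ffun 'I_j -> word b n} => injectiveb X)) /=.
    apply: ler_wpDr; first by apply: sumr_ge0 => X _; rewrite !mulr_ge0 ?exprn_ge0.
    apply: (@le_trans _ _ (\sum_(X : {ffun 'I_j -> word b n} | (X \in ffun_on (mem (D o))) && injectiveb X) e o ^+ j * H)).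
      rewrite sumr_const -[leRHS]mulr_natr mulrAC -mulrA le_eqVlt; apply/orP; left; apply/eqP.
      congr (_ * (_%:R * _)); have := card_inj_ffuns_on 'I_j (mem (D o)); rewrite card_ord => <-.
      by apply: eq_card => X; rewrite !inE.
    apply: ler_sum => X /andP[/ffun_onP XD /injectiveP Xinj].
    rewrite -mulrA ler_wpM2l ?exprn_ge0 // mulrC.
    by apply: hansel => // t; apply: (subsetP (DC o)); exact: XD.
  move=> avgL; apply: le_trans (_ : #|D o|%:R * (e o ^+ j * ((#|D o| ^_ j)%:R * H)) <= _); last first.
    by rewrite ler_pM2l.
  have := ffact_ge R j s0 => ff.
  rewrite [leLHS](_ : _ = #|D o|%:R * (e o ^+ j * ((#|D o|%:R ^+ j * (1 - (j ^ 2)%:R / #|D o|%:R)) * H))).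
    by rewrite !ler_wpM2l ?exprn_ge0 // ler_wpM2r.
  by rewrite /e exprVn; field; rewrite expf_neq0 ?gt_eqF.
have key : (\sum_o (#|D o|%:R - (j ^ 2)%:R)) * H <= (N * K)%:R * (\sum_o w o * avg o) * L.
  rewrite !big_distrl big_distrr big_distrl /=; apply: ler_sum => o _.
  apply: le_trans (lower o) _; rewrite /w.
  by rewrite [_ / _ * avg o]mulrAC [(N * K)%:R * _]mulrC divfK ?gt_eqF // mulrA.
have sumE : \sum_o (#|D o|%:R - (j ^ 2)%:R) = (N * K)%:R - (j ^ 2 * #|W|)%:R :> R.
  rewrite sumrB sumr_const [(j ^ 2 * _)%:R]natrM [_ * #|W|%:R]mulr_natr; congr (_ - _).
  rewrite (eq_bigr (fun o => \sum_(x in D o) 1)); last by move=> o _; rewrite sumr_const.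
  by rewrite sumD sumr_const -natrM mulnC.
rewrite -sumE; apply: le_trans key _; rewrite -mulrA ler_pM2l // ler_wpM2r //.
Qed.

(** * Subcodes cut out by cyclic windows *)

(** Translations permute the cyclic group ['I_b.+1], so every window is as large as the initial
    one. *)
Lemma card_window (b m : nat) (r : 'I_b.+1) : (m <= b.+1)%N ->
  #|[set a : 'I_b.+1 | ((a + r)%R < m)%N]| = m.
Proof.
move=> mb; pose A := [set a : 'I_b.+1 | (a < m)%N].
have -> : [set a : 'I_b.+1 | ((a + r)%R < m)%N] = (fun a => a + r) @^-1: A.
  by apply/setP => a; rewrite !inE.
rewrite on_card_preimset; last first.
  by exists (fun a => a - r) => a _; rewrite ?addrK ?subrK.
rewrite -sum1_card (eq_bigl (fun a : 'I_b.+1 => (a < m)%N)); last by move=> a; rewrite inE.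
by rewrite -(big_ord_widen _ (fun=> 1%N) mb) sum1_card card_ord.
Qed.

Lemma card_family_prod (I J : finType) (Q : I -> pred J) :
  #|family Q| = (\prod_i #|Q i|)%N.
Proof. by rewrite card_family foldrE big_image. Qed.

Lemma card_ord_lt (n l : nat) : (l <= n)%N -> #|[set i : 'I_n | (i < l)%N]| = l.
Proof.
case: n => [|n] ln; first by move: ln; rewrite leqn0 => /eqP ->; apply: eq_card0 => -[].
rewrite -[RHS](card_window 0 ln); apply: eq_card => i; rewrite !inE.
by rewrite addr0.
Qed.

(** The index [o] shifts every coordinate, and a word is kept if its first [l] shifted symbols lie
    below [i.+1], one less than the tuple length [i.+2]. For a fixed word the admissible shifts form
    a product set, so all words lie in equally many subcodes. *)
Lemma hash_code_bound (R : realType) (b i n l : nat) (C : {set word b n}) :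
  (i.+4 <= b)%N -> (forall m, (0 < m <= b)%N -> uniform_check b i m) ->
  is_hash_code i.+4 C -> (0 < #|C|)%N -> (l <= n)%N ->
  ((#|C| * i.+1 ^ l)%:R - (i.+2 ^ 2 * b ^ l)%:R) * ((#|C| - i.+2)%:R * ln (#|C| - i.+2)%:R) <=
  (#|C| * i.+1 ^ l)%:R *
  (#|C|%:R * (n - l)%:R * ((b ^_ i.+3)%:R / b%:R ^+ i.+3) * ln (b - i.+2)%:R) :> R.
Proof.
move=> ib chk; case: b ib chk C => // b ib chk C hC C0 le_ln.
pose ok o (x : word b.+1 n) := [forall s : 'I_n, (s < l)%N ==> ((x s + o s)%R < i.+1)%N].
pose D (o : {ffun 'I_n -> 'I_b.+1}) := [set x in C | ok o x].
pose Z := [set s : 'I_n | (s < l)%N].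
have ib' : (i.+1 <= b.+1)%N by rewrite (leq_trans _ ib) // -addn3 leq_addr.
have DK x : x \in C -> #|[set o | x \in D o]| = (i.+1 ^ l * b.+1 ^ (n - l))%N.
  move=> xC.
  pose Q (s : 'I_n) : pred 'I_b.+1 := [pred a | (s < l)%N ==> ((a + x s)%R < i.+1)%N].
  have -> : #|[set o | x \in D o]| = #|family Q|.
    apply: eq_card => o; rewrite inE [x \in D o]inE xC /=; apply/forallP/familyP => oQ s.
      by have := oQ s; rewrite addrC.
    by have := oQ s; rewrite inE addrC.
  rewrite card_family_prod (bigID (fun s : 'I_n => (s < l)%N)) /=; congr (_ * _)%N.
    rewrite (eq_bigr (fun=> i.+1)); last first.
      move=> s sl; rewrite -[RHS](card_window (x s) ib'); apply: eq_card => a.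
      by rewrite !inE sl.
    rewrite prod_nat_const -[in RHS](card_ord_lt le_ln); congr (_ ^ _)%N.
    by apply: eq_card => s; rewrite !inE.
  rewrite (eq_bigr (fun=> b.+1)); last first.
    move=> s sl; rewrite -[RHS]card_ord; apply: eq_card => a.
    by rewrite !inE (negbTE sl).
  rewrite prod_nat_const; congr (_ ^ _)%N.
  have := cardsC Z; rewrite card_ord card_ord_lt // => E; apply: (@addnI l); rewrite subnKC // -[RHS]E.
  by congr (_ + _)%N; apply: eq_card => s; rewrite !inE.
have K0 : (0 < i.+1 ^ l * b.+1 ^ (n - l))%N by rewrite muln_gt0 !expn_gt0.
have DZ o s : s \in Z -> (#|[set x s | x : word b.+1 n in D o]| < i.+2)%N.
  rewrite inE => sl; rewrite ltnS -[X in (_ <= X)%N](card_window (o s) ib').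
  apply/subset_leq_card/subsetP => _ /imsetP[x + ->]; rewrite !inE => /andP[_ /forallP/(_ s)].
  by rewrite sl.
have DC o : D o \subset C by apply/subsetP => x; rewrite inE => /andP[].
have ib3 : (i.+3 <= b.+1)%N by exact: ltnW.
pose g : R := ((b.+1 - 2) ^_ i.+1)%:R / b.+1%:R ^+ i.+1.
have c0 : 0 < 2 * g.
  by rewrite mulr_gt0 // divr_gt0 ?exprn_gt0 ?ltr0n // ffact_gt0 leq_subRL // (leq_trans _ ib3).
have := hash_code_family_bound ib3 hC C0 K0 DC DK DZ c0
  (fun q qs => @potential_le R b.+1 i q ib3 chk qs).
rewrite card_ffun !card_ord card_ord_lt // .
have -> : (b.+1 ^ n = b.+1 ^ l * b.+1 ^ (n - l))%N by rewrite -expnD subnKC.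
rewrite !mulnA ![in (_ * b.+1 ^ (n - l))%:R]natrM -mulrBl.
set E := (b.+1 ^ (n - l))%:R.
have E0 : 0 < E by rewrite ltr0n expn_gt0.
by rewrite ![_ * E * _]mulrAC ler_pM2r.
Qed.

(** * Passage to the rate *)

Lemma limn_esup_le_near (R : realType) (u : nat -> \bar R) (l : \bar R) (n0 : nat) :
  (forall n, (n0 <= n)%N -> (u n <= l)%E) -> (limn_esup u <= l)%E.
Proof.
move=> ul; rewrite limn_esup_lim; apply: lime_le; first exact: is_cvg_esups.
exists n0 => // m /= n0m; apply: ge_ereal_sup => _ [k /= mk <-].
by apply: ul; rewrite (leq_trans n0m).
Qed.

(** Decay from [1 + y <= expR y]; it turns asymptotic comparisons into explicit thresholds on
    [n]. *)
Lemma expR_inv_small (R : realType) (K a e x : R) :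
  0 <= K -> 0 < e -> 0 < a -> K / (e * a) <= x -> K * expR (- (a * x)) <= e.
Proof.
move=> K0 e0 a0 Kx; rewrite expRN ler_pdivrMr ?expR_gt0 //.
apply: (@le_trans _ _ (e * (1 + a * x))).
  by move: Kx; rewrite ler_pdivrMr ?mulr_gt0 // => Kx; nra.
by rewrite ler_pM2l // expR_ge1Dx.
Qed.

(** Suppose [#|C|] exceeds 2 to the power [t * n], and let a proportion [al] of the coordinates be
    forced to collide. Then [al * P < t] makes the repetition term negligible, and the other
    coordinates bound the rate by about [(1 - al) * U * Q], which is below [t]. *)
Lemma hash_code_ln_le (R : realType) (b i A q n : nat) (P Q t e : R) (C : {set word b n}) :
  (i.+4 <= b)%N -> (forall m, (0 < m <= b)%N -> uniform_check b i m) ->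
  (A <= q)%N -> (0 < q)%N ->
  ln (b%:R / i.+1%:R) <= P * ln 2 -> ln (b - i.+2)%:R <= Q * ln 2 ->
  let al := A%:R / q%:R in let U := (b ^_ i.+3)%:R / b%:R ^+ i.+3 in
  0 < t -> al * P < t -> (1 - al) * U * Q < t ->
  0 < e -> e <= 4^-1 -> 4 * e * t <= t - (1 - al) * U * Q ->
  (i.+2 ^ 2)%:R / (e * ((t - al * P) * ln 2)) <= n%:R ->
  i.+2%:R / (e * (t * ln 2)) <= n%:R ->
  1 <= t * n%:R ->
  2 * (U * Q + 1) < (t - (1 - al) * U * Q) * n%:R ->
  is_hash_code i.+4 C -> ln #|C|%:R <= t * ln 2 * n%:R.
Proof.
move=> ib chk Aq q0 lnP lnQ al U t0 aP uQ e0 e4 et n1 n2 n3 n4 hC.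
rewrite leNgt; apply/negP => big.
set lam := ln 2 in lnP lnQ n1 n2 big; have lam0 : 0 < lam by rewrite ln_gt0 // ltr1n.
have n0 : 0 <= n%:R :> R by [].
have C0 : (0 < #|C|)%N.
  (* The convention [ln 0 = 0] puts the empty code within the bound. *)
  rewrite lt0n; apply/negP => /eqP C0; move: big; rewrite C0 ln0 // ltNge => /negP; apply.
  by rewrite !mulr_ge0 // ltW.
set N := #|C| in C0 big; have N0 : 0 < N%:R :> R by rewrite ltr0n.
have qR : 0 < q%:R :> R by rewrite ltr0n.
have al0 : 0 <= al by rewrite divr_ge0.
have al1 : al <= 1 by rewrite ler_pdivrMr // mul1r ler_nat.
have b0 : 0 < b%:R :> R by rewrite ltr0n (leq_trans _ ib).
have U0 : 0 <= U by rewrite divr_ge0 ?exprn_ge0.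
have i0 : 0 < i.+1%:R :> R by rewrite ltr0n.
have P0 : 0 <= P.
  have : 0 <= P * lam.
    apply: le_trans lnP; rewrite ln_ge0 // ler_pdivlMr // mul1r ler_nat.
    by rewrite (leq_trans _ ib) // -addn3 leq_addr.
  by rewrite pmulr_lge0.
have bi2 : (i.+2 < b)%N by rewrite (leq_trans _ ib) // ltnW.
have L0 : 0 <= ln (b - i.+2)%:R :> R by rewrite ln_ge0 // ler1n subn_gt0.
have Q0 : 0 <= Q by have := le_trans L0 lnQ; rewrite pmulr_lge0.
have expN : expR (t * lam * n%:R) <= N%:R by rewrite -[leRHS]lnK ?posrE // ler_expR ltW.
pose l := (A * n %/ q)%N.
have lal : l%:R <= al * n%:R.
  by rewrite /al mulrAC ler_pdivlMr // -!natrM ler_nat leq_trunc_div.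
(* Rounding down loses at most one coordinate, the source of the [+ 1] in [up]. *)
have lal' : al * n%:R <= l%:R + 1.
  by rewrite /al mulrAC ler_pdivrMr // natr1 -!natrM ler_nat ltnW // ltn_ceil.
have le_ln : (l <= n)%N.
  by rewrite -(ler_nat R) (le_trans lal) // ler_piMl.
have lnb : b%:R ^+ l <= i.+1%:R ^+ l * expR (al * P * lam * n%:R) :> R.
  have bi : 0 < b%:R / i.+1%:R :> R by rewrite divr_gt0.
  rewrite -[b%:R](divfK (lt0r_neq0 i0)) exprMn mulrC ler_pM2l ?exprn_gt0 //.
  rewrite -{1}[_ / _](lnK bi) -expRM_natl ler_expR.
  apply: (@le_trans _ _ (l%:R * (P * lam))); first by rewrite ler_wpM2l.
  apply: (@le_trans _ _ (al * n%:R * (P * lam))); first by rewrite ler_wpM2r // mulr_ge0 // ltW.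
  by rewrite le_eqVlt; apply/orP; left; apply/eqP; ring.
have small1 : (i.+2 ^ 2)%:R * expR (al * P * lam * n%:R) <= e * N%:R.
  have a0 : 0 < (t - al * P) * lam by rewrite mulr_gt0 // subr_gt0.
  have := expR_inv_small (ler0n _ _) e0 a0 n1 => sm.
  apply: le_trans (_ : e * expR (t * lam * n%:R) <= _); last by rewrite ler_pM2l.
  rewrite (_ : expR (al * P * lam * n%:R) =
    expR (- ((t - al * P) * lam * n%:R)) * expR (t * lam * n%:R)); last by rewrite -expRD; congr expR; ring.
  by rewrite mulrA ler_wpM2r // ltW // expR_gt0.
have small2 : i.+2%:R <= e * N%:R.
  have a0 : 0 < t * lam by rewrite mulr_gt0.
  have := expR_inv_small (ler0n _ _) e0 a0 n2 => sm.
  apply: le_trans (_ : e * expR (t * lam * n%:R) <= _); last by rewrite ler_pM2l.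
  by move: sm; rewrite expRN ler_pdivrMr ?expR_gt0.
have jN : (i.+2 <= N)%N.
  rewrite -(ler_nat R) (le_trans small2) // ler_piMl // (le_trans e4) //.
  by rewrite invf_le1 // ler1n.
have core := @hash_code_bound R b i n l C ib chk hC C0 le_ln.
rewrite -/N -/U natrB // natrB // !natrM !natrX in core.
set v : R := N%:R - i.+2%:R in core.
have vN : (1 - e) * N%:R <= v by rewrite /v; lra.
have vN2 : N%:R / 2 <= v by rewrite /v; nra.
(* Halving [N] costs one binary unit, hence the [- 1]. *)
have lnv : (t * n%:R - 1) * lam <= ln v.
  apply: (@le_trans _ _ (ln (N%:R / 2))); last first.
    by rewrite ler_ln ?posrE // ?(lt_le_trans _ vN2) // divr_gt0.
  by rewrite ln_div ?posrE // -/lam mulrBl mul1r lerD2r ltW // mulrAC.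
have tn1 : 0 <= t * n%:R - 1 by rewrite subr_ge0.
have I0 : 0 < i.+1%:R ^+ l :> R by rewrite exprn_gt0.
set I1 := i.+1%:R ^+ l in core lnb I0.
have e1 : 0 <= 1 - e by rewrite subr_ge0 (le_trans e4) // invf_le1 // ler1n.
have low : N%:R * I1 * N%:R * lam * ((1 - e) ^+ 2 * (t * n%:R - 1)) <=
    (N%:R * I1 - i.+2%:R ^+ 2 * b%:R ^+ l) * (v * ln v).
  apply: (@le_trans _ _ (((1 - e) * (N%:R * I1)) * (((1 - e) * N%:R) * ((t * n%:R - 1) * lam)))).
    by rewrite le_eqVlt; apply/orP; left; apply/eqP; ring.
  apply: ler_pM.
  - by rewrite !mulr_ge0 // ltW.
  - by rewrite !mulr_ge0 // ltW.
  - rewrite mulrBl mul1r lerD2l lerN2.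
    apply: (@le_trans _ _ (i.+2%:R ^+ 2 * (I1 * expR (al * P * lam * n%:R)))).
      by rewrite ler_pM2l // exprn_gt0.
    rewrite mulrCA -natrX [leRHS]mulrA [leRHS]mulrC ler_pM2l //.
  - by apply: ler_pM => //; rewrite mulr_ge0 // ltW.
have up : (N%:R * I1) * (N%:R * (n%:R - l%:R) * U * ln (b - i.+2)%:R) <=
    N%:R * I1 * N%:R * lam * (((1 - al) * n%:R + 1) * (U * Q)).
  apply: (@le_trans _ _ ((N%:R * I1) * (N%:R * ((1 - al) * n%:R + 1) * U * (Q * lam)))); last first.
    by rewrite le_eqVlt; apply/orP; left; apply/eqP; ring.
  rewrite ler_pM2l ?mulr_gt0 //; apply: ler_pM => //.
    by rewrite !mulr_ge0 // subr_ge0 ler_nat.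
  by rewrite ler_wpM2r // ler_pM2l //; lra.
have := le_trans low (le_trans core up).
rewrite ler_pM2l ?mulr_gt0 // => fin.
have sq : (1 - 2 * e) * (t * n%:R - 1) <= (1 - e) ^+ 2 * (t * n%:R - 1).
  by rewrite ler_wpM2r // -subr_ge0 (_ : _ - _ = e ^+ 2) ?sqr_ge0 //; ring.
(* The loss [2 * e * t * n] is at most half of the gap [t - (1 - al) * U * Q] times [n]; the other
   half exceeds [U * Q + 1]. *)
have et' : 4 * e * t * n%:R <= (t - (1 - al) * U * Q) * n%:R by rewrite ler_wpM2r.
set T := (1 - e) ^+ 2 * _ in fin sq.
clearbody T al U; lra.
Qed.

Lemma hash_rate_le (R : realType) (b i A q : nat) (P Q t : R) :
  (i.+4 <= b)%N -> (forall m, (0 < m <= b)%N -> uniform_check b i m) ->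
  (A <= q)%N -> (0 < q)%N ->
  ln (b%:R / i.+1%:R) <= P * ln 2 -> ln (b - i.+2)%:R <= Q * ln 2 ->
  0 < t -> A%:R / q%:R * P < t ->
  (1 - A%:R / q%:R) * ((b ^_ i.+3)%:R / b%:R ^+ i.+3) * Q < t ->
  (hash_rate R b i.+4 <= t%:E)%E.
Proof.
move=> ib chk Aq q0 lnP lnQ t0 aP uQ.
set al := A%:R / q%:R in aP uQ; set U := _ / _ in uQ; set s := (1 - al) * U * Q in uQ.
have lam0 : 0 < ln 2 :> R by rewrite ln_gt0 // ltr1n.
have ts : 0 < t - s by rewrite subr_gt0.
pose e := Num.min 4^-1 ((t - s) / (4 * t)).
have e0 : 0 < e by rewrite lt_min invr_gt0 ltr0n /= divr_gt0 // mulr_gt0.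
have e4 : e <= 4^-1 by rewrite ge_min lexx.
have et : 4 * e * t <= t - s.
  rewrite mulrAC mulrC -ler_pdivlMr ?mulr_gt0 //.
  by rewrite ge_min lexx orbT.
(* The four lower bounds that [hash_code_ln_le] puts on [n]; the [+ 1] makes the last one strict. *)
pose thr := [:: (i.+2 ^ 2)%:R / (e * ((t - al * P) * ln 2)); i.+2%:R / (e * (t * ln 2));
  t^-1; 2 * (U * Q + 1) / (t - s) + 1].
pose n0 := (\max_(x <- thr) Num.bound `|x|%R)%N.
have thrP n x : (n0 <= n)%N -> x \in thr -> x <= n%:R.
  move=> n0n xt; apply: le_trans (ler_norm x) _; apply: le_trans (ltW (archi_boundP (normr_ge0 x))) _.
  rewrite ler_nat; apply: leq_trans n0n.
  exact: (@leq_bigmax_seq _ thr xpredT (fun x : R => Num.bound `|x|) x xt).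
apply: (@limn_esup_le_near _ _ _ n0.+1) => n n0n; rewrite lee_fin.
have n0n' : (n0 <= n)%N by exact: ltnW.
have nR : 0 < n%:R :> R by rewrite ltr0n (leq_trans _ n0n).
rewrite ler_pdivrMr // /log2 ler_pdivrMr // mulrAC.
(* The maximum is attained, since the empty set is a code: it has no subset of [i.+4] elements. *)
have [C hC ->] : {C : {set word b n} | is_hash_code i.+4 C & A_hash b i.+4 n = #|C|}.
  apply: eq_bigmax_cond; apply/card_gt0P; exists set0; rewrite unfold_in /=.
  apply/forallP => S; apply/implyP => /andP[]; rewrite subset0 => /eqP ->.
  by rewrite cards0.
apply: (hash_code_ln_le (e := e) ib chk Aq q0 lnP lnQ t0 aP uQ e0 e4 et) => //.
- by apply: thrP => //; rewrite !inE eqxx.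
- by apply: thrP => //; rewrite !inE eqxx orbT.
- by rewrite mulrC -ler_pdivrMr // div1r; apply: thrP => //; rewrite !inE eqxx !orbT.
- rewrite [ltRHS]mulrC -ltr_pdivrMr //; apply: (@lt_le_trans _ _ (2 * (U * Q + 1) / (t - s) + 1)).
    by rewrite ltrDl.
  by apply: thrP => //; rewrite !inE eqxx !orbT.
Qed.

(** * Numerical certificates *)

Local Notation toN := BinNat.N.of_nat.

Lemma toND (m n : nat) : toN (m + n)%N = BinNat.N.add (toN m) (toN n).
Proof. exact: Nnat.Nat2N.inj_add. Qed.

Lemma toNM (m n : nat) : toN (m * n)%N = BinNat.N.mul (toN m) (toN n).
Proof. exact: Nnat.Nat2N.inj_mul. Qed.

Lemma toNX (m n : nat) : toN (m ^ n)%N = BinNat.N.pow (toN m) (toN n).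
Proof.
elim: n => [|n IH]; first by rewrite expn0.
by rewrite expnS toNM IH Nnat.Nat2N.inj_succ BinNat.N.pow_succ_r'.
Qed.

(** Large products are formed in binary, where they can be computed; only the small arguments stay
    unary. *)
Fixpoint ffactN (m k : nat) : BinNums.N := if k is k'.+1 then BinNat.N.mul (toN m) (ffactN m.-1 k') else toN 1.

Lemma toN_ffact (m k : nat) : toN (m ^_ k) = ffactN m k.
Proof. by elim: k m => [|k IH] m; rewrite ?ffactn0 // ffactnS toNM IH. Qed.

Lemma leq_toN (m n : nat) : (m <= n)%N = BinNat.N.leb (toN m) (toN n).
Proof.
rewrite BinNat.N.leb_compare -Nnat.Nat2N.inj_compare -PeanoNat.Nat.leb_compare.
by apply/ssrnat.leP/idP => /PeanoNat.Nat.leb_le.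
Qed.

Lemma ltn_toN (m n : nat) : (m < n)%N = BinNat.N.ltb (toN m) (toN n).
Proof. by rewrite ltnNge leq_toN BinNat.N.ltb_antisym. Qed.

Definition uniform_checkN (b i m : nat) : bool :=
  let X := BinNat.N.mul (ffactN m.-1 i.+1) (BinNat.N.pow (toN b) (toN i.+1)) in
  let Y := BinNat.N.mul (BinNat.N.pow (toN m) (toN i.+1)) (ffactN (b - 2) i.+1) in
  BinNat.N.leb
    (BinNat.N.add (BinNat.N.mul (toN (8 * m * (b - i.+2))) (BinNat.N.mul X Y))
       (BinNat.N.mul (toN (b - m)) (BinNat.N.add (BinNat.N.mul (toN 4) (BinNat.N.mul Y Y)) (BinNat.N.mul (toN (i.+2 * i.+2)) (BinNat.N.mul X X)))))
    (BinNat.N.add (BinNat.N.mul (toN (8 * m * (b - 1))) (BinNat.N.mul Y Y)) (BinNat.N.mul (toN (4 * (b - m) * i.+2)) (BinNat.N.mul X Y))).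

Lemma uniform_checkNE (b i m : nat) : uniform_checkN b i m = uniform_check b i m.
Proof.
by rewrite /uniform_checkN /uniform_check leq_toN !(toN_ffact, toNX, toND, toNM).
Qed.

(* [A / q] is the proportion of the coordinates on which the tuples are made to collide;
   [p1 / q1] and [p2 / q2] bound [log2 (b / (k - 3))] and [log2 (b - k + 2)] from above. *)
Definition certificate (b i T A q p1 q1 p2 q2 : nat) : bool :=
  [&& [&& (i.+4 <= b)%N, all (uniform_checkN b i) (iota 1 b), (A <= q)%N & (0 < q)%N],
      [&& (0 < q1)%N, (0 < q2)%N & (0 < T)%N]
      & [&& BinNat.N.leb (BinNat.N.pow (toN b) (toN q1)) (BinNat.N.mul (BinNat.N.pow (toN 2) (toN p1)) (BinNat.N.pow (toN i.+1) (toN q1))),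
        BinNat.N.leb (BinNat.N.pow (toN (b - i.+2)) (toN q2)) (BinNat.N.pow (toN 2) (toN p2)),
        BinNat.N.ltb (BinNat.N.mul (toN (A * p1)) (toN 100000)) (BinNat.N.mul (toN T) (toN (q * q1)))
        & BinNat.N.ltb (BinNat.N.mul (BinNat.N.mul (toN ((q - A) * p2)) (ffactN b i.+3)) (toN 100000))
           (BinNat.N.mul (BinNat.N.mul (toN T) (toN (q * q2))) (BinNat.N.pow (toN b) (toN i.+3)))]].

(** Raising to the power [q] turns a rational bound on a binary logarithm into an inequality between
    naturals. *)
Lemma ln_le_certificate (R : realType) (x y p q : nat) : (0 < x)%N -> (0 < y)%N -> (0 < q)%N ->
  (x ^ q <= 2 ^ p * y ^ q)%N -> ln (x%:R / y%:R) <= p%:R / q%:R * ln 2 :> R.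
Proof.
move=> x0 y0 q0 xy.
have xR : 0 < x%:R :> R by rewrite ltr0n.
have yR : 0 < y%:R :> R by rewrite ltr0n.
have qR : 0 < q%:R :> R by rewrite ltr0n.
rewrite mulrAC ler_pdivlMr // ![_ * ln 2]mulr_natl mulr_natr -!lnXn ?divr_gt0 //.
rewrite ler_ln ?posrE ?exprn_gt0 ?divr_gt0 // expr_div_n ler_pdivrMr ?exprn_gt0 //.
by rewrite -!natrX -natrM ler_nat.
Qed.

Lemma certificateP (R : realType) (b i T A q p1 q1 p2 q2 : nat) :
  certificate b i T A q p1 q1 p2 q2 ->
  (hash_rate R b i.+4 <= (T%:R / 100000%:R)%:E)%E.
Proof.
(* An opaque [h] keeps the unary numeral 100000 from being unfolded. *)
have [h hE] : {h | h = 100000%N} by exists 100000%N.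
rewrite /certificate -hE => /and3P[/and4P[ib /allP chk Aq q0] /and3P[q10 q20 T0] /and4P[c1 c2 c3 c4]].
have h0 : (0 < h)%N by rewrite hE.
clear hE.
have b0 : (0 < b)%N by apply: leq_trans ib.
have bi : (0 < b - i.+2)%N by rewrite subn_gt0 (leq_trans _ ib) // ltnW.
have qR : 0 < q%:R :> R by rewrite ltr0n.
have q1R : 0 < q1%:R :> R by rewrite ltr0n.
have q2R : 0 < q2%:R :> R by rewrite ltr0n.
have hR : 0 < h%:R :> R by rewrite ltr0n.
have bR : 0 < b%:R ^+ i.+3 :> R by rewrite exprn_gt0 // ltr0n.
apply: (@hash_rate_le R b i A q (p1%:R / q1%:R) (p2%:R / q2%:R)) => //.
- by move=> m /andP[m0 mb]; rewrite -uniform_checkNE; apply: chk; rewrite mem_iota m0 addnC addn1 ltnS.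
- apply: ln_le_certificate => //; rewrite leq_toN toNM !toNX; exact: c1.
- rewrite -[(b - i.+2)%:R]divr1; apply: (@ln_le_certificate R (b - i.+2) 1) => //.
  by rewrite exp1n muln1 leq_toN !toNX.
- by rewrite divr_gt0 // ltr0n.
- have : (A * p1 * h < T * (q * q1))%N by rewrite ltn_toN !(toNM (A * p1), toNM T).
  rewrite -(ltr_nat R) !natrM => c3R.
  by rewrite mulf_div ltr_pdivrMr ?mulr_gt0 // mulrAC ltr_pdivlMr.
have : ((q - A) * p2 * b ^_ i.+3 * h < T * (q * q2) * b ^ i.+3)%N.
  by rewrite ltn_toN !(toNM (_ * _ * _), toNM (_ * p2), toNM (T * _), toNM T) toN_ffact toNX.
have -> : b%:R ^+ i.+3 = (b ^ i.+3)%:R :> R by rewrite natrX.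
have : (0 < b ^ i.+3)%N by rewrite expn_gt0 b0.
move: (b ^_ i.+3)%N (b ^ i.+3)%N => F B B0; have {}bR : 0 < B%:R :> R by rewrite ltr0n.
rewrite -(ltr_nat R) !natrM natrB // => c4R.
rewrite (_ : _ * _ * _ = (q%:R - A%:R) * p2%:R * F%:R / (q%:R * q2%:R * B%:R)); last by field; rewrite !gt_eqF.
rewrite ltr_pdivrMr ?mulr_gt0 // [ltRHS]mulrAC ltr_pdivlMr //.
by rewrite [ltRHS]mulrA.
Qed.

Unset Implicit Arguments.

Theorem mainTheorem4 (R : realType) :
  (hash_rate R 5 5 <= (16894%:R / 100000%:R)%:E)%E /\
  (hash_rate R 6 5 <= (34512%:R / 100000%:R)%:E)%E /\
  (hash_rate R 6 6 <= (8475%:R / 100000%:R)%:E)%E /\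
  (hash_rate R 7 6 <= (19897%:R / 100000%:R)%:E)%E /\
  (hash_rate R 8 6 <= (31799%:R / 100000%:R)%:E)%E /\
  (hash_rate R 9 6 <= (43237%:R / 100000%:R)%:E)%E /\
  (hash_rate R 10 6 <= (53909%:R / 100000%:R)%:E)%E /\
  (hash_rate R 11 6 <= (63766%:R / 100000%:R)%:E)%E /\
  (hash_rate R 12 6 <= (72848%:R / 100000%:R)%:E)%E /\
  (hash_rate R 13 6 <= (81227%:R / 100000%:R)%:E)%E /\
  (hash_rate R 14 6 <= (88978%:R / 100000%:R)%:E)%E /\
  (hash_rate R 7 7 <= (4090%:R / 100000%:R)%:E)%E /\
  (hash_rate R 8 7 <= (10865%:R / 100000%:R)%:E)%E /\
  (hash_rate R 9 7 <= (19054%:R / 100000%:R)%:E)%E /\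
  (hash_rate R 10 7 <= (27741%:R / 100000%:R)%:E)%E /\
  (hash_rate R 11 7 <= (36424%:R / 100000%:R)%:E)%E /\
  (hash_rate R 12 7 <= (44850%:R / 100000%:R)%:E)%E /\
  (hash_rate R 13 7 <= (52902%:R / 100000%:R)%:E)%E /\
  (hash_rate R 14 7 <= (60538%:R / 100000%:R)%:E)%E /\
  (hash_rate R 8 8 <= (1889%:R / 100000%:R)%:E)%E /\
  (hash_rate R 9 8 <= (5616%:R / 100000%:R)%:E)%E /\
  (hash_rate R 10 8 <= (10791%:R / 100000%:R)%:E)%E /\
  (hash_rate R 11 8 <= (16878%:R / 100000%:R)%:E)%E /\
  (hash_rate R 12 8 <= (23451%:R / 100000%:R)%:E)%E /\
  (hash_rate R 13 8 <= (30214%:R / 100000%:R)%:E)%E /\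
  (hash_rate R 14 8 <= (36974%:R / 100000%:R)%:E)%E /\
  (hash_rate R 10 9 <= (2773%:R / 100000%:R)%:E)%E /\
  (hash_rate R 11 9 <= (5796%:R / 100000%:R)%:E)%E /\
  (hash_rate R 12 9 <= (9730%:R / 100000%:R)%:E)%E /\
  (hash_rate R 13 9 <= (14332%:R / 100000%:R)%:E)%E /\
  (hash_rate R 14 9 <= (19382%:R / 100000%:R)%:E)%E /\
  (hash_rate R 11 10 <= (1321%:R / 100000%:R)%:E)%E /\
  (hash_rate R 12 10 <= (2978%:R / 100000%:R)%:E)%E /\
  (hash_rate R 13 10 <= (5342%:R / 100000%:R)%:E)%E /\
  (hash_rate R 14 10 <= (8332%:R / 100000%:R)%:E)%E /\
  (hash_rate R 13 11 <= (1476%:R / 100000%:R)%:E)%E /\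
  (hash_rate R 14 11 <= (2815%:R / 100000%:R)%:E)%E /\
  (hash_rate R 14 12 <= (712%:R / 100000%:R)%:E)%E /\
  (hash_rate R 15 13 <= (335%:R / 100000%:R)%:E)%E.
Proof.
(* In each line [i] is [k - 4] and [T] is the bound in units of 1/100000. The proportion [A / q]
   brings both [A / q * P] and [(1 - A / q) * U * Q] below it; the best proportion would make them
   equal, which gives the harmonic formula for the rate. *)
split; first by apply: (@certificateP R 5 1 16894 1 8 4 3 1 1); vm_compute.
split; first by apply: (@certificateP R 6 1 34512 5 23 46 29 46 29); vm_compute.
split; first by apply: (@certificateP R 6 2 8475 5 59 1 1 1 1); vm_compute.
split; first by apply: (@certificateP R 7 2 19897 173 1063 390 319 485 306); vm_compute.
split; first by apply: (@certificateP R 8 2 31799 291 1295 75 53 2 1); vm_compute.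
split; first by apply: (@certificateP R 9 2 43237 407 1492 317 200 476 205); vm_compute.
split; first by apply: (@certificateP R 10 2 53909 815 2626 601 346 791 306); vm_compute.
split; first by apply: (@certificateP R 11 2 63766 116 341 448 239 685 244); vm_compute.
split; first by apply: (@certificateP R 12 2 72848 55 151 2 1 3 1); vm_compute.
split; first by apply: (@certificateP R 13 2 81227 498 1297 806 381 485 153); vm_compute.
split; first by apply: (@certificateP R 14 2 88978 219 547 1269 571 1651 497); vm_compute.
split; first by apply: (@certificateP R 7 3 4090 1 21 5 6 1 1); vm_compute.
split; first by apply: (@certificateP R 8 3 10865 49 451 1 1 317 200); vm_compute.
split; first by apply: (@certificateP R 9 3 19054 107 657 179 153 2 1); vm_compute.
split; first by apply: (@certificateP R 10 3 27741 64 305 271 205 476 205); vm_compute.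
split; first by apply: (@certificateP R 11 3 36424 145 581 54 37 654 253); vm_compute.
split; first by apply: (@certificateP R 12 3 44850 88 311 233 147 685 244); vm_compute.
split; first by apply: (@certificateP R 13 3 52902 373 1199 335 197 3 1); vm_compute.
split; first by apply: (@certificateP R 14 3 60538 277 827 441 244 485 153); vm_compute.
split; first by apply: (@certificateP R 8 4 1889 1 53 1 1 1 1); vm_compute.
split; first by apply: (@certificateP R 9 4 5616 19 287 67 79 65 41); vm_compute.
split; first by apply: (@certificateP R 10 4 10791 41 380 1 1 2 1); vm_compute.
split; first by apply: (@certificateP R 11 4 16878 50 337 215 189 137 59); vm_compute.
split; first by apply: (@certificateP R 12 4 23451 119 641 24 19 517 200); vm_compute.
split; first by apply: (@certificateP R 13 4 30214 263 1200 193 140 379 135); vm_compute.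
split; first by apply: (@certificateP R 14 4 36974 57 229 153 103 3 1); vm_compute.
split; first by apply: (@certificateP R 10 5 2773 1 27 17 23 46 29); vm_compute.
split; first by apply: (@certificateP R 11 5 5796 238 3593 7 8 2 1); vm_compute.
split; first by apply: (@certificateP R 12 5 9730 18 185 1 1 137 59); vm_compute.
split; first by apply: (@certificateP R 13 5 14332 51 397 164 147 380 147); vm_compute.
split; first by apply: (@certificateP R 14 5 19382 94 593 280 229 685 244); vm_compute.
split; first by apply: (@certificateP R 11 6 1321 1 51 2 3 27 17); vm_compute.
split; first by apply: (@certificateP R 12 6 2978 2 53 7 9 2 1); vm_compute.
split; first by apply: (@certificateP R 13 6 5342 15 251 42 47 137 59); vm_compute.
split; first by apply: (@certificateP R 14 6 8332 413 4957 1 1 791 306); vm_compute.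
split; first by apply: (@certificateP R 13 7 1476 1 49 5 7 2 1); vm_compute.
split; first by apply: (@certificateP R 14 7 2815 4 115 21 26 137 59); vm_compute.
split; first by apply: (@certificateP R 14 8 712 1 94 2 3 2 1); vm_compute.
by apply: (@certificateP R 15 9 335 1 299 1 1 2 1); vm_compute.
Qed.
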